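(* Let $\mathcal{D}_F=D_F+\mathcal{D}_{\min}$, with $D_F\subset\mathcal{E}$, be the domain of the Friedrichs extension of $A_c$. Consider the curve $\lambda\mapsto K_\lambda\in\mathrm{Gr}_d(\mathcal{E})$, where $\lambda$ ranges over the negative real numbers for which $A_{\mathcal{D}_{\min}}-\lambda$ is injective (this includes all sufficiently negative $\lambda$). Then $K_\lambda\to D_F$ in $\mathrm{Gr}_d(\mathcal{E})$ as $\lambda\to-\infty$.
   Context: Setting: $H$ is a separable (complex) Hilbert space with inner product $(\cdot,\cdot)$, and $A_c:\mathcal{D}_c\subset H\to H$ is a densely defined unbounded symmetric operator bounded from below (there is $m\in\mathbb{R}$ with $(A_cu,u)\ge m\|u\|^2$ for $u\in\mathcal{D}_c$). $A:\mathcal{D}_{\max}\subset H\to H$ is the adjoint of $A_c$ (an extension of $A_c$). $\mathcal{D}_{\max}$ is a Hilbert space with inner product $(u,v)_A=(Au,Av)+(u,v)$. $\mathcal{D}_{\min}$ is the domain of the closure of $A_c$ (the closure of $\mathcal{D}_c$ in $\mathcal{D}_{\max}$). It is assumed that the inclusion $\mathcal{D}_{\max}\hookrightarrow H$ is compact and that $\mathcal{D}_{\min}$ has finite positive codimension in $\mathcal{D}_{\max}$. For a subspace $\mathcal{D}$ with $\mathcal{D}_{\min}\subset\mathcal{D}\subset\mathcal{D}_{\max}$, $A_{\mathcal{D}}$ denotes $A$ with domain $\mathcal{D}$. $\mathcal{E}$ is the orthogonal complement of $\mathcal{D}_{\min}$ in $\mathcal{D}_{\max}$ with respect to $(\cdot,\cdot)_A$;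 its dimension is $2d$ where $d=-\operatorname{ind}A_{\mathcal{D}_{\min}}>0$. $\mathrm{Gr}_d(\mathcal{E})$ is the Grassmannian of $d$-dimensional subspaces of $\mathcal{E}$ with its usual topology. $\pi_{\max}:\mathcal{D}_{\max}\to\mathcal{D}_{\max}$ is the $(\cdot,\cdot)_A$-orthogonal projection on $\mathcal{E}$. $\mathcal{K}_\lambda=\ker(A_{\mathcal{D}_{\max}}-\lambda)$ and $K_\lambda=\pi_{\max}\mathcal{K}_\lambda$; if $A_{\mathcal{D}_{\min}}-\lambda$ is injective ($\lambda\in\mathbb{R}$) then $\dim K_\lambda=d$. *)

(* Defs.v *)
From HB Require Import structures.
From mathcomp Require Import all_boot all_order all_algebra.
From mathcomp Require Import sesquilinear complex.
From mathcomp Require Import all_classical all_reals topology normedtype.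

Set Implicit Arguments.
Unset Strict Implicit.
Unset Printing Implicit Defensive.

Import Order.TTheory GRing.Theory Num.Theory.
Import numFieldNormedType.Exports.

Local Open Scope classical_set_scope.
Local Open Scope ring_scope.
Local Open Scope complex_scope.

Definition separable (T : topologicalType) : Prop :=
  exists S : set T, countable S /\ dense S.

Section Dimension.
Context {K : fieldType} {V : lmodType K}.
Implicit Types (U W : set V) (n : nat).

Definition lin_subspace U : Prop :=
  U 0 /\ forall (a : K) (u v : V), U u -> U v -> U (a *: u + v).

Definition lincomb n (b : 'I_n -> V) (c : 'I_n -> K) : V :=
  \sum_i c i *: b i.

Definition lin_span n (b : 'I_n -> V) : set V := range (lincomb b).

(* The classes of b in U / W form a basis of this quotient. *)
Definition basis_mod W U n (b : 'I_n -> V) : Prop :=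
  [/\ forall i, U (b i),
      forall c, W (lincomb b c) -> forall i, c i = 0
    & forall u, U u -> exists c, W (u - lincomb b c)].

Definition has_codim W U n : Prop :=
  exists b : 'I_n -> V, basis_mod W U b.

(* dim (U / W), with value 0 when this quotient is infinite dimensional. *)
Definition codim W U : nat := xget 0%N [set n | has_codim W U n].

Definition dim U : nat := codim [set 0] U.

Definition frames U n : set ('I_n -> V) :=
  [set b | (forall i, U (b i)) /\
           forall c, lincomb b c = 0 -> forall i, c i = 0].

End Dimension.
Arguments frames {K V} U n.

Record Gr (K : fieldType) (V : lmodType K) (E : set V) (d : nat) := MkGr {
  gr_set :> set V;
  gr_setP : exists2 b, frames E d b & @lin_span K V d b = gr_set
}.

HB.instance Definition _ (K : fieldType) (V : lmodType K) E d :=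
  gen_eqMixin (@Gr K V E d).
HB.instance Definition _ (K : fieldType) (V : lmodType K) E d :=
  gen_choiceMixin (@Gr K V E d).

(* The quotient topology for the map sending a frame (d independent vectors of
   E, with the topology induced by the product V^d) to its span.  When E is
   finite dimensional, the topology induced on E by any norm is the same. *)
Section GrassmannianTopology.
Context {K : numFieldType} {V : normedModType K} (E : set V) (d : nat).

Definition gr_preimage (U : set (Gr E d)) : set {ptws 'I_d -> V} :=
  [set b | frames E d b /\ exists2 W, U W & lin_span b = gr_set W].

Definition gr_open (U : set (Gr E d)) : Prop :=
  exists2 O : set {ptws 'I_d -> V}, open O &
    gr_preimage U = (frames E d : set {ptws 'I_d -> V}) `&` O.

Lemma gr_eq (W1 W2 : Gr E d) : gr_set W1 = gr_set W2 -> W1 = W2.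
Proof.
case: W1 W2 => [W1 h1] [W2 h2] /= e; case: _ / e h2 => h2.
by congr MkGr; exact: Prop_irrelevance.
Qed.

Lemma gr_openT : gr_open setT.
Proof.
exists setT; first exact: openT.
rewrite setIT; apply/seteqP; split=> [b []//|b fb]; split => //.
have h : exists2 b', frames E d b' & lin_span b' = lin_span b by exists b.
by exists (MkGr h).
Qed.

Lemma gr_openI : setI_closed gr_open.
Proof.
move=> A B [O1 oO1 e1] [O2 oO2 e2]; exists (O1 `&` O2); first exact: openI.
rewrite setIIr -e1 -e2; apply/seteqP; split.
  by move=> b [fb [W [AW BW] sW]]; split; split=> //; exists W.
move=> b [[fb [W AW sW]] [_ [W' BW' sW']]]; split => //; exists W => //.
by split=> //; suff -> : W = W' by []; apply: gr_eq; rewrite -sW.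
Qed.

Lemma gr_open_bigU (I : Type) (f : I -> set (Gr E d)) :
  (forall i, gr_open (f i)) -> gr_open (\bigcup_i f i).
Proof.
move=> /(_ _)/cid2-/all_sig2[O oO eO]; exists (\bigcup_i O i).
  exact: bigcup_open.
rewrite setI_bigcupr; apply/seteqP; split.
  move=> b [fb [W [i _ fW] sW]]; exists i => //; rewrite -eO.
  by split=> //; exists W.
move=> b [i _]; rewrite -eO => -[fb [W fW sW]].
by split=> //; exists W => //; exists i.
Qed.

HB.instance Definition _ := isOpenTopological.Build (Gr E d)
  gr_openT gr_openI gr_open_bigU.

End GrassmannianTopology.

Section Operators.
Context {R : realType} {H : completeNormedModType R[i]}.
Context (ip : {dot H for Num.conj}).

(* A partially defined operator; the values of act outside dom are junk. *)
Record operator := Operator { dom : set H; act :> H -> H }.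

Implicit Types (T : operator) (D : set H).

Definition linear_operator T : Prop :=
  lin_subspace (dom T) /\
  forall (a : R[i]) (u v : H), dom T u -> dom T v ->
    T (a *: u + v) = a *: T u + T v.

Definition densely_defined T : Prop := dense (dom T).

Definition symmetric_operator T : Prop :=
  forall u v : H, dom T u -> dom T v -> ip (T u) v = ip u (T v).

Definition bounded_below T : Prop :=
  exists m : R, forall u : H, dom T u -> m%:C * `|u| ^+ 2 <= ip (T u) u.

Definition adjoint_graph T (v w : H) : Prop :=
  forall u : H, dom T u -> ip (T u) v = ip u w.

Definition adjoint T : operator :=
  Operator [set v | exists w, adjoint_graph T v w]
           (fun v => xget 0 [set w | adjoint_graph T v w]).

Definition graph T : set (H * H) := [set (u, T u) | u in dom T].

Definition closure_dom T : set H := [set u | exists w, closure (graph T) (u, w)].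

Definition restriction T D : operator := Operator D T.

Definition op_kernel T (z : R[i]) : set H := [set u | dom T u /\ T u = z *: u].

Definition injective_shift T (z : R[i]) : Prop :=
  set_inj (dom T) (fun u : H => T u - z *: u).

Definition fredholm_index T : int :=
  (dim (op_kernel T 0))%:Z - (codim (T @` dom T) [set: H])%:Z.

Definition graph_ip T (u v : H) : R[i] := ip (T u) (T v) + ip u v.

Definition compact_inclusion T : Prop :=
  precompact [set u | dom T u /\ graph_ip T u u <= 1].

Definition graph_ortho T D : set H :=
  [set u | dom T u /\ forall v, D v -> graph_ip T u v = 0].

Definition graph_proj T D (u : H) : H :=
  xget 0 [set e | D e /\ forall v, D v -> graph_ip T (u - e) v = 0].

(* Convergence for the quadratic form (T u, u): the sequence converges in H
   and is Cauchy for the form. *)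
Definition form_cvg T (u_ : nat -> H) (u : H) : Prop :=
  [/\ forall n, dom T (u_ n),
      u_ n @[n --> \oo] --> u
    & ip (T (u_ p.1 - u_ p.2)) (u_ p.1 - u_ p.2) @[p --> (\oo, \oo)]
        --> (0 : R[i]^o)].

Definition form_dom T : set H := [set u | exists u_, form_cvg T u_ u].

(* The closure of the form (T u, v), as the relation t(u, v) = z. *)
Definition closed_form T (u v : H) (z : R[i]) : Prop :=
  forall u_ v_ : nat -> H, form_cvg T u_ u -> form_cvg T v_ v ->
    ip (T (u_ n)) (v_ n) @[n --> \oo] --> (z : R[i]^o).

(* The domain of the operator associated with the closure of the form. *)
Definition friedrichs_dom T : set H :=
  [set u | form_dom T u /\
     exists w, forall v, form_dom T v -> closed_form T u v (ip w v)].

End Operators.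

Section Extensions.
Context {R : realType} {H : completeNormedModType R[i]}.
Context (ip : {dot H for Num.conj}) (Ac : operator (H := H)).

Definition Amax : operator := adjoint ip Ac.
Definition Dmax : set H := dom Amax.
Definition Dmin : set H := closure_dom Ac.
Definition Amin : operator := restriction Amax Dmin.

Definition Espace : set H := graph_ortho ip Amax Dmin.
Definition pi_max : H -> H := graph_proj ip Amax Espace.

Definition Kspace (l : R) : set H := pi_max @` op_kernel Amax l%:C.

End Extensions.

(* Main.v *)
Require Import Defs.
From mathcomp Require Import all_boot all_order all_algebra.
From mathcomp Require Import sesquilinear complex.
From mathcomp Require Import all_classical all_reals topology normedtype.
From mathcomp Require Import ring lra sequences.
Import Order.TTheory GRing.Theory Num.Theory.
Import numFieldNormedType.Exports.
Set Implicit Arguments.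
Unset Strict Implicit.
Unset Printing Implicit Defensive.
Local Open Scope classical_set_scope.
Local Open Scope ring_scope.
Local Open Scope complex_scope.

Local Notation Re := complex.Re.

(* Write [u, v] = (A u, v) - (u, A v).  On E one has A^2 = -1 and
   [u, A r] = (u, r)_A, so E is the (.,.)_A-orthogonal sum of L and A L for
   every Lagrangian subspace L, and all Lagrangian subspaces have the same
   dimension.  Compactness gives A_min - l closed range for every real l,
   whence K_l is Lagrangian; for l = 0 its dimension is the index d.  D_F is
   Lagrangian because the Friedrichs extension is self-adjoint.

   Let l = -s, let q in K_l have (q, q)_A <= 1, and write q = k - w with k in
   ker (A - l) and w in D_min.  Expanding (A k, k) = -s |k|^2 gives
   |k| = O(s^(-1/2)) and a bound on the form (A w, w), both uniform in q.  If f
   is in D_F and x in D_c is close to f in form norm, then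
   [f, q] = (A f - A x, k) - (A f - A x, w) - (f - x, A q),
   so [f, q] -> 0 uniformly in q.  Finally, if r is the component of f
   orthogonal to K_l, then A r is in K_l and (r, r)_A = [f, A r]; hence r -> 0,
   and the projections to K_l of an orthonormal frame of D_F converge to it. *)

(** * Real-valued norms *)

(** The obstacle is that f in D_F is in general not in D_min: for x in D_c near f, the vector A f -
    A x need not be small in H. It is small only as a functional measured against the form norm. On
    the other side, as l tends to -oo the part w of q is controlled in form norm only, while k tends
    to 0 in H. The two kinds of smallness are matched: A f - A x is paired with w through the form
    and with k through H, and x is fixed before l is sent to -oo.

    The range of A_min - l, D_min and D_c are handled without assuming that they are complete for
    the inner products used on them. Projections and solutions of form equations are therefore built
    from Cauchy sequences of approximate minimisers; the limits are taken in H and identified by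
    closedness of the operator or closability of the form. *)

Section RealNorm.
Context {R : realType}.
Implicit Types (z : R[i]).

Lemma ReD z1 z2 : Re (z1 + z2) = Re z1 + Re z2.
Proof. by case: z1 z2 => [? ?] [? ?]. Qed.

Lemma ReN z : Re (- z) = - Re z.
Proof. by case: z. Qed.

Lemma ReB z1 z2 : Re (z1 - z2) = Re z1 - Re z2.
Proof. by rewrite ReD ReN. Qed.

Lemma ReZ (x : R) z : Re (x%:C * z) = x * Re z.
Proof. by case: z => a b /=; rewrite mul0r subr0. Qed.

Lemma Re_conjc z : Re (Num.conj z) = Re z.
Proof. by case: z. Qed.

(** Norms on an [R[i]]-module take values in [R[i]]; the real part moves them to the ordered field
    R, where real arithmetic applies. *)
Definition rnorm {V : normedZmodType R[i]} (v : V) : R := Re `|v|.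

Section Zmod.
Context {V : normedZmodType R[i]}.
Implicit Types u v : V.

Lemma rnormE v : `|v| = (rnorm v)%:C.
Proof. by rewrite /rnorm RRe_real// ger0_real. Qed.

Lemma rnorm_ge0 v : 0 <= rnorm v.
Proof. by rewrite -ler0c -rnormE. Qed.

Lemma rnorm0_eq0 v : rnorm v = 0 -> v = 0.
Proof. by move=> h; apply/normr0_eq0; rewrite rnormE h rmorph0. Qed.

Lemma rnormD u v : rnorm (u + v) <= rnorm u + rnorm v.
Proof. by rewrite -lecR rmorphD/= -!rnormE ler_normD. Qed.

Lemma rnormN v : rnorm (- v) = rnorm v.
Proof. by rewrite /rnorm normrN. Qed.

Lemma rnormB u v : rnorm (u - v) <= rnorm u + rnorm v.
Proof. by rewrite -[rnorm v]rnormN rnormD. Qed.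

Lemma rdistC u v : rnorm (u - v) = rnorm (v - u).
Proof. by rewrite -rnormN opprB. Qed.

End Zmod.

Lemma rnormM z1 z2 : rnorm (z1 * z2) = rnorm z1 * rnorm z2.
Proof. by apply: complexI; rewrite rmorphM/= -!rnormE normrM. Qed.

Lemma rnormZ (V : normedModType R[i]) z (v : V) :
  rnorm (z *: v) = rnorm z * rnorm v.
Proof. by apply: complexI; rewrite rmorphM/= -!rnormE normrZ. Qed.

Lemma rnorm_real (x : R) : rnorm x%:C = `|x|.
Proof. by rewrite /rnorm normc_def /= expr0n addr0 sqrtr_sqr. Qed.

Lemma rnorm_conj z : rnorm (Num.conj z) = rnorm z.
Proof. by case: z => a b; rewrite /rnorm !normc_def /= sqrrN. Qed.

Lemma sqr_rnorm z : rnorm z ^+ 2 = Re (Num.conj z * z).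
Proof.
rewrite /rnorm normc_def sqr_sqrtr ?addr_ge0 ?sqr_ge0//.
by case: z => a b /=; rewrite mulNr opprK !expr2.
Qed.

Lemma Re_le_rnorm z : Re z <= rnorm z.
Proof.
rewrite (le_trans (ler_norm _))// /rnorm normc_def /= -sqrtr_sqr.
by rewrite ler_wsqrtr// lerDl sqr_ge0.
Qed.

End RealNorm.

(** * Linear independence modulo a subspace *)

Section Subspaces.
Context {K : fieldType} {V : lmodType K}.
Implicit Types (U W : set V).

Lemma subspace0 U : lin_subspace U -> U 0.
Proof. by case. Qed.

Lemma subspaceZ U a u : lin_subspace U -> U u -> U (a *: u).
Proof. by move=> [U0 h] Uu; rewrite -[_ *: u]addr0; exact: h. Qed.

Lemma subspaceD U u v : lin_subspace U -> U u -> U v -> U (u + v).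
Proof. by move=> [U0 h] Uu Uv; rewrite -[u]scale1r; exact: h. Qed.

Lemma subspaceN U u : lin_subspace U -> U u -> U (- u).
Proof. by move=> hU Uu; rewrite -scaleN1r; exact: subspaceZ. Qed.

Lemma subspaceB U u v : lin_subspace U -> U u -> U v -> U (u - v).
Proof. by move=> hU Uu Uv; apply: subspaceD => //; exact: subspaceN. Qed.

Lemma subspace_lincomb U n (b : 'I_n -> V) c :
  lin_subspace U -> (forall i, U (b i)) -> U (lincomb b c).
Proof.
move=> hU Ub; rewrite /lincomb; elim/big_ind: _ => [|u v|i _].
- exact: subspace0.
- exact: subspaceD.
- exact: subspaceZ.
Qed.

Lemma subspace_set0 : lin_subspace ([set 0] : set V).
Proof. by split=> [//|a u v /= -> ->]; rewrite scaler0 addr0. Qed.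

Lemma lincombD n (b : 'I_n -> V) c1 c2 :
  lincomb b (fun i => c1 i + c2 i) = lincomb b c1 + lincomb b c2.
Proof. by rewrite /lincomb -big_split/=; apply: eq_bigr => i _; rewrite scalerDl. Qed.

Lemma lincombZ n (b : 'I_n -> V) a c :
  lincomb b (fun i => a * c i) = a *: lincomb b c.
Proof. by rewrite /lincomb scaler_sumr; apply: eq_bigr => i _; rewrite scalerA. Qed.

Lemma lincomb0 n (b : 'I_n -> V) : lincomb b (fun=> 0) = 0.
Proof. by rewrite /lincomb big1// => i _; rewrite scale0r. Qed.

Lemma lincomb_unit n (b : 'I_n -> V) i : lincomb b (fun j => (j == i)%:R) = b i.
Proof.
rewrite /lincomb (bigD1 i)//= eqxx scale1r big1 ?addr0// => j /negPf ->.
by rewrite scale0r.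
Qed.

Lemma lincombBv n (b b' : 'I_n -> V) c :
  lincomb b c - lincomb b' c = lincomb (fun i => b i - b' i) c.
Proof.
by rewrite /lincomb -sumrB; apply: eq_bigr => i _; rewrite scalerBr.
Qed.

Lemma subspace_span n (b : 'I_n -> V) : lin_subspace (lin_span b).
Proof.
split; first by exists (fun=> 0) => //; exact: lincomb0.
move=> a _ _ [c1 _ <-] [c2 _ <-]; exists (fun i => a * c1 i + c2 i) => //.
by rewrite lincombD lincombZ.
Qed.

Lemma span_mem n (b : 'I_n -> V) i : lin_span b (b i).
Proof. by exists (fun j => (j == i)%:R) => //; exact: lincomb_unit. Qed.

Lemma span_sub n (b : 'I_n -> V) U :
  lin_subspace U -> (forall i, U (b i)) -> lin_span b `<=` U.
Proof. by move=> hU Ub _ [c _ <-]; exact: subspace_lincomb. Qed.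

Definition famcat m n (b : 'I_m -> V) (b' : 'I_n -> V) (i : 'I_(m + n)) : V :=
  match fintype.split i with inl j => b j | inr j => b' j end.

Lemma lincomb_famcat m n (b : 'I_m -> V) (b' : 'I_n -> V) c :
  lincomb (famcat b b') c =
  lincomb b (fun i => c (lshift n i)) + lincomb b' (fun i => c (rshift m i)).
Proof.
rewrite /lincomb big_split_ord /=; congr (_ + _); apply: eq_bigr => i _.
  by rewrite /famcat (unsplitK (inl i)).
by rewrite /famcat (unsplitK (inr i)).
Qed.

Definition catc m n (c : 'I_m -> K) (c' : 'I_n -> K) (i : 'I_(m + n)) : K :=
  match fintype.split i with inl j => c j | inr j => c' j end.

Lemma lincomb_catc m n (b : 'I_m -> V) (b' : 'I_n -> V) c c' :
  lincomb (famcat b b') (catc c c') = lincomb b c + lincomb b' c'.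
Proof.
rewrite lincomb_famcat; congr (_ + _); apply: eq_bigr => i _.
  by rewrite /catc (unsplitK (inl i)).
by rewrite /catc (unsplitK (inr i)).
Qed.

Lemma famcat_ind m n (b : 'I_m -> V) (b' : 'I_n -> V) U :
  (forall i, U (b i)) -> (forall i, U (b' i)) -> forall i, U (famcat b b' i).
Proof. by move=> hb hb' i; rewrite /famcat; case: fintype.split. Qed.

Lemma catc_eq0 m n (c : 'I_(m + n) -> K) :
  (forall i, c (lshift n i) = 0) -> (forall i, c (rshift m i) = 0) ->
  forall i, c i = 0.
Proof. by move=> h1 h2 i; rewrite -(splitK i); case: fintype.split. Qed.

(** If a row x kills the coefficient matrix, the combination of the b_i with coefficients x is also
    a combination of the errors [b i - lincomb g (c i)], hence lies in W. Independence modulo W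
    gives x = 0, so the k by n matrix has independent rows. *)
Lemma indep_mod_le W k n (b : 'I_k -> V) (g : 'I_n -> V) :
  lin_subspace W -> (forall i, exists c, W (b i - lincomb g c)) ->
  (forall c, W (lincomb b c) -> forall i, c i = 0) -> (k <= n)%N.
Proof.
move=> hW /(_ _)/cid-/all_sig[c hc] bfree.
pose M := \matrix_(i < k, j < n) c i j.
suff : row_free M by rewrite /row_free => /eqP <-; exact: rank_leq_col.
rewrite -kermx_eq0; apply/eqP/row_matrixP => i; rewrite row0.
have : row i (kermx M) *m M = 0 by rewrite -row_mul mulmx_ker row0.
move: (row i _) => x xM; apply/rowP => j; rewrite [RHS]mxE.
apply: (bfree (fun j => x 0 j)).
have -> : lincomb b (fun j => x 0 j) =
    \sum_i0 x 0 i0 *: (b i0 - lincomb g (c i0)).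
  under [RHS]eq_bigr do rewrite scalerBr.
  rewrite sumrB [X in _ = _ - X](_ : _ = 0) ?subr0//.
  under eq_bigr do rewrite /lincomb scaler_sumr.
  rewrite exchange_big big1//= => j0 _.
  under eq_bigr do rewrite scalerA.
  rewrite -scaler_suml (_ : \sum_i _ = (x *m M) 0 j0); last first.
    by rewrite mxE; apply: eq_bigr => i1 _; rewrite !mxE.
  by rewrite xM mxE scale0r.
elim/big_ind: _ => [|u v|i0 _]; [exact: subspace0|exact: subspaceD|].
exact: subspaceZ.
Qed.

(** Since [codim] is a chosen value, it can be computed only once any two bases modulo W are known
    to have the same length; each is compared with the other. *)
Lemma codimE W U n : lin_subspace W -> has_codim W U n -> codim W U = n.
Proof.
move=> hW hn; rewrite /codim; case: xgetP => [m _ hm|/(_ n)]; last by [].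
case: hn hm => b [Ub bfree bspan] [b' [Ub' bfree' bspan']].
apply/eqP; rewrite eqn_leq; apply/andP; split.
  by apply: indep_mod_le bfree' => // i; exact: bspan.
by apply: indep_mod_le bfree => // i; exact: bspan'.
Qed.

Lemma indep_le k n (b : 'I_k -> V) (g : 'I_n -> V) :
  (forall i, lin_span g (b i)) ->
  (forall c, lincomb b c = 0 -> forall i, c i = 0) -> (k <= n)%N.
Proof.
move=> hb bfree; apply: (@indep_mod_le [set 0] _ _ b g) => //.
  exact: subspace_set0.
by move=> i; have [c _ <-] := hb i; exists c; rewrite /= subrr.
Qed.

Lemma indep_append n (b : 'I_n -> V) v :
  (forall c, lincomb b c = 0 -> forall i, c i = 0) -> ~ lin_span b v ->
  forall c, lincomb (famcat b (fun _ : 'I_1 => v)) c = 0 -> forall i, c i = 0.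
Proof.
move=> bfree nv c; rewrite lincomb_famcat.
set c1 := fun i => c (lshift 1 i); set c2 := fun i => c (rshift n i) => e.
have c20 : c2 0 = 0.
  apply: contrapT => /eqP c2n0; apply: nv.
  exists (fun i => - (c2 0)^-1 * c1 i) => //; rewrite lincombZ.
  move: e; rewrite [X in _ + X]/lincomb big_ord1 => /eqP; rewrite addr_eq0 => /eqP ->.
  by rewrite scaleNr scalerN opprK scalerA mulVf// scale1r.
apply: catc_eq0 => i; last by rewrite -/(c2 i) (ord1 i).
apply: (bfree c1); move: e; rewrite [X in _ + X]/lincomb big_ord1.
by rewrite c20 scale0r addr0.
Qed.

(** A vector of the span of g outside the span of b could be appended to b, giving n + 1 independent
    vectors in a span of n. *)
Lemma indep_span n (b g : 'I_n -> V) :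
  (forall i, lin_span g (b i)) ->
  (forall c, lincomb b c = 0 -> forall i, c i = 0) -> lin_span b = lin_span g.
Proof.
move=> hb bfree; apply/seteqP; split; first exact: span_sub (subspace_span g) hb.
move=> v gv; apply: contrapT => nv.
have := @indep_le _ _ (famcat b (fun _ : 'I_1 => v)) g.
rewrite -[X in (_ <= X)%N]addn0 leq_add2l => /(_ _ _)/wrap[]//; last first.
  exact: indep_append.
exact: famcat_ind.
Qed.

End Subspaces.
(** * Hermitian forms on a subspace *)

Section PreInner.
Context {R : realType} {V : lmodType R[i]}.

(* A positive semidefinite hermitian form, required to behave well only on the
   subspace D. *)
Record pre_inner (D : set V) (f : V -> V -> R[i]) : Prop := PreInner {
  pi_sub : lin_subspace D;
  pi_lin : forall a u v w, D u -> D v -> D w ->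
    f (a *: u + v) w = a * f u w + f v w;
  pi_herm : forall u v, D u -> D v -> f u v = Num.conj (f v u);
  pi_ge0 : forall u, D u -> 0 <= Re (f u u) }.

Definition quad (f : V -> V -> R[i]) u : R := Re (f u u).

Context {D : set V} {f : V -> V -> R[i]} (hf : pre_inner D f).
Let hD := pi_sub hf.
Implicit Types u v w : V.

Lemma pi0l w : D w -> f 0 w = 0.
Proof.
move=> Dw; have := pi_lin hf 1 (subspace0 hD) (subspace0 hD) Dw.
rewrite scaler0 addr0 mul1r => /eqP; rewrite eq_sym -subr_eq0 addrK.
by move/eqP.
Qed.

Lemma piDl u v w : D u -> D v -> D w -> f (u + v) w = f u w + f v w.
Proof. by move=> *; rewrite -{1}(scale1r u) (pi_lin hf)// mul1r. Qed.

Lemma piZl a u w : D u -> D w -> f (a *: u) w = a * f u w.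
Proof.
move=> *; rewrite -(addr0 (a *: u)) (pi_lin hf)//; last exact: subspace0.
by rewrite pi0l// addr0.
Qed.

Lemma piNl u w : D u -> D w -> f (- u) w = - f u w.
Proof. by move=> *; rewrite -scaleN1r piZl// mulN1r. Qed.

Lemma piBl u v w : D u -> D v -> D w -> f (u - v) w = f u w - f v w.
Proof. by move=> *; rewrite piDl ?piNl//; exact: subspaceN. Qed.

Lemma piDr u v w : D u -> D v -> D w -> f w (u + v) = f w u + f w v.
Proof.
move=> Du Dv Dw; rewrite (pi_herm hf)//; last exact: subspaceD.
by rewrite piDl// rmorphD/= -!(pi_herm hf).
Qed.

Lemma piZr a u w : D u -> D w -> f w (a *: u) = Num.conj a * f w u.
Proof.
move=> Du Dw; rewrite (pi_herm hf)//; last exact: subspaceZ.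
by rewrite piZl// rmorphM/= -(pi_herm hf).
Qed.

Lemma piNr u w : D u -> D w -> f w (- u) = - f w u.
Proof. by move=> *; rewrite -scaleN1r piZr// rmorphN1 mulN1r. Qed.

Lemma piBr u v w : D u -> D v -> D w -> f w (u - v) = f w u - f w v.
Proof. by move=> *; rewrite piDr ?piNr//; exact: subspaceN. Qed.

Lemma pi_lincomb n (b : 'I_n -> V) c w : (forall i, D (b i)) -> D w ->
  f (lincomb b c) w = \sum_i c i * f (b i) w.
Proof.
move=> Db Dw; pose P u z := D u /\ f u w = z.
suff [] : P (lincomb b c) (\sum_i c i * f (b i) w) by [].
rewrite /lincomb; elim/big_ind2: _ => [|u x v y [Du <-] [Dv <-]|i _].
- by split; [exact: subspace0|exact: pi0l].
- by split; [exact: subspaceD|exact: piDl].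
- by split; [exact: subspaceZ|exact: piZl].
Qed.

Lemma quadE u : D u -> f u u = (quad f u)%:C.
Proof.
move=> Du; rewrite /quad RRe_real//.
by rewrite CrealE; apply/eqP; rewrite -(pi_herm hf).
Qed.

Lemma quad_ge0 u : D u -> 0 <= quad f u.
Proof. exact: (pi_ge0 hf). Qed.

Lemma quadDZ a u v : D u -> D v ->
  quad f (u + a *: v) =
  quad f u + 2 * Re (Num.conj a * f u v) + rnorm a ^+ 2 * quad f v.
Proof.
move=> Du Dv; have Dav := subspaceZ a hD Dv; have Dsum := subspaceD hD Du Dav.
rewrite /quad piDl// !piDr// !piZr// !piZl// !ReD.
rewrite (pi_herm hf Dv Du) -(Re_conjc (a * _)) rmorphM/= conjCK.
rewrite mulrA sqr_rnorm (quadE Dv) [_ * _%:C]mulrC ReZ /=.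
by rewrite /quad; ring.
Qed.

Lemma quadZ a v : D v -> quad f (a *: v) = rnorm a ^+ 2 * quad f v.
Proof.
move=> Dv; rewrite -[a *: v]add0r quadDZ//; last exact: subspace0.
by rewrite /quad !pi0l//; [rewrite mulr0/=; ring|exact: subspace0].
Qed.

Lemma quadN v : D v -> quad f (- v) = quad f v.
Proof. by move=> Dv; rewrite -scaleN1r quadZ// rnormN /rnorm normr1/= expr1n mul1r. Qed.

(* Optimise a - 2 t b + t^2 b c at t = 1 / c. *)
Lemma quadratic_bound (a b c : R) : 0 <= b -> 0 <= c ->
  (forall t, 0 <= a - 2 * t * b + t ^+ 2 * b * c) -> b <= a * c.
Proof.
move=> b0; rewrite le_eqVlt => /predU1P[<-|c0] h.
  rewrite mulr0 leNgt; apply/negP => bp.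
  have := h ((a + 1) / (2 * b)); rewrite mulr0 addr0.
  rewrite (_ : 2 * _ * b = a + 1); last by field; rewrite gt_eqF.
  by lra.
have := h c^-1; rewrite -(ler_pM2r c0).
rewrite (_ : (_ + _) * c = a * c - b); last by field; rewrite gt_eqF.
by lra.
Qed.

(** The test vector is u - t f(u, v) v with t real: the factor f(u, v) turns the cross term into -2
    t |f(u, v)|^2. The form may be degenerate, so no division by [quad f v] occurs here. *)
Lemma pi_cauchy_sqr u v : D u -> D v -> rnorm (f u v) ^+ 2 <= quad f u * quad f v.
Proof.
move=> Du Dv; apply: quadratic_bound (sqr_ge0 _) (quad_ge0 Dv) _ => t.
have /quad_ge0 : D (u + (- (t%:C * f u v)) *: v).
  by apply: subspaceD => //; exact: subspaceZ.
rewrite quadDZ// rmorphN rmorphM/=.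
rewrite (_ : Num.conj t%:C = t%:C); last by rewrite -[LHS]/(t%:C^*) conjc_real.
rewrite mulNr -mulrA ReN ReZ -sqr_rnorm rnormN rnormM rnorm_real exprMn.
by rewrite real_normK ?num_real//; lra.
Qed.

Definition pnorm (g : V -> V -> R[i]) u : R := Num.sqrt (quad g u).

Lemma pnorm_ge0 u : 0 <= pnorm f u. Proof. exact: sqrtr_ge0. Qed.

Lemma sqr_pnorm u : D u -> pnorm f u ^+ 2 = quad f u.
Proof. by move=> Du; rewrite sqr_sqrtr// quad_ge0. Qed.

Lemma pi_cauchy u v : D u -> D v -> rnorm (f u v) <= pnorm f u * pnorm f v.
Proof.
move=> Du Dv; rewrite -(@ler_pXn2r _ 2)// ?nnegrE ?mulr_ge0 ?pnorm_ge0 ?rnorm_ge0//.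
by rewrite exprMn !sqr_pnorm// pi_cauchy_sqr.
Qed.

Lemma pnormD u v : D u -> D v -> pnorm f (u + v) <= pnorm f u + pnorm f v.
Proof.
move=> Du Dv; rewrite -(@ler_pXn2r _ 2)// ?nnegrE ?addr_ge0 ?pnorm_ge0//.
rewrite sqr_pnorm; last exact: subspaceD.
rewrite -[X in quad f (_ + X)]scale1r quadDZ// rmorph1 mul1r /rnorm normr1/= expr1n mul1r.
rewrite sqrrD !sqr_pnorm//.
have := le_trans (Re_le_rnorm _) (pi_cauchy Du Dv); lra.
Qed.

Lemma pnormZ a u : D u -> pnorm f (a *: u) = rnorm a * pnorm f u.
Proof.
move=> Du; rewrite /pnorm quadZ// sqrtrM ?sqr_ge0// sqrtr_sqr.
by rewrite ger0_norm ?rnorm_ge0.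
Qed.

Lemma pnormN u : D u -> pnorm f (- u) = pnorm f u.
Proof. by move=> Du; rewrite /pnorm quadN. Qed.

Lemma pnormB u v : D u -> D v -> pnorm f (u - v) <= pnorm f u + pnorm f v.
Proof.
by move=> Du Dv; rewrite -[pnorm f v]pnormN// pnormD//; exact: subspaceN.
Qed.

Lemma pnorm_lincomb n (b : 'I_n -> V) c : (forall i, D (b i)) ->
  pnorm f (lincomb b c) <= \sum_i rnorm (c i) * pnorm f (b i).
Proof.
move=> Db; pose P u (x : R) := D u /\ pnorm f u <= x.
suff [] : P (lincomb b c) (\sum_i rnorm (c i) * pnorm f (b i)) by [].
rewrite /lincomb; elim/big_ind2: _ => [|u x v y [Du ux] [Dv vy]|i _].
- split; first exact: subspace0.
  by rewrite /pnorm /quad pi0l ?sqrtr0//; exact: subspace0.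
- by split; [exact: subspaceD|rewrite (le_trans (pnormD _ _))// lerD].
- by split; [exact: subspaceZ|rewrite pnormZ].
Qed.

(* Minimise the energy quad f u - 2 Re (phi u); at an eps-minimiser u the
   variation in direction v bounds f u v - phi v. *)
Lemma riesz_approx1 (phi : V -> R[i]) (M : R) : 0 <= M ->
  (forall a u v, D u -> D v -> phi (u + a *: v) = phi u + Num.conj a * phi v) ->
  (forall v, D v -> rnorm (phi v) ^+ 2 <= M * quad f v) ->
  forall e : R, 0 < e -> exists2 u, D u &
    forall v, D v -> rnorm (f u v - phi v) ^+ 2 <= e * quad f v.
Proof.
move=> M0 phil phiM e e0; pose J u : R := quad f u - 2 * Re (phi u).
(* The energy is bounded below because 2 |phi u| <= 2 sqrt(M q) <= M + q with q = [quad f u]. *)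
have JM u : D u -> - M <= J u.
  move=> Du; have := phiM _ Du; have := quad_ge0 Du.
  have := Re_le_rnorm (phi u); have := rnorm_ge0 (phi u); rewrite /J.
  move: (rnorm _) (Re _) (quad _ _) => x r q x0 rx q0 xq.
  suff : 2 * x <= M + q by lra.
  rewrite -(@ler_pXn2r _ 2)// ?nnegrE; [|by lra|by lra].
  by have := sqr_ge0 (M - q); nra.
have hJ : has_inf (J @` D).
  split; first by exists (J 0), 0 => //; exact: subspace0.
  by exists (- M) => _ [u Du <-]; exact: JM.
have [_ [u Du <-] Ju] := inf_adherent e0 hJ.
exists u => // v Dv; set r := f u v - phi v.
apply: quadratic_bound (sqr_ge0 _) (quad_ge0 Dv) _ => t.
have Dw : D (u + (- (t%:C * r)) *: v).
  by apply: subspaceD => //; exact: subspaceZ.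
have : inf (J @` D) <= J (u + (- (t%:C * r)) *: v).
  by apply: ge_inf; [case: hJ|exists (u + (- (t%:C * r)) *: v)].
move: Ju; move: (inf _) => I Ju.
rewrite [X in _ <= X]/J quadDZ// phil// rmorphN rmorphM/=.
rewrite (_ : Num.conj t%:C = t%:C); last by rewrite -[LHS]/(t%:C^*) conjc_real.
rewrite ReD !mulNr -!(mulrA t%:C) !ReN !ReZ rnormN rnormM rnorm_real exprMn.
rewrite real_normK ?num_real//.
have -> : rnorm r ^+ 2 = Re (Num.conj r * f u v) - Re (Num.conj r * phi v).
  by rewrite -ReB -mulrBr sqr_rnorm.
by rewrite /J in Ju; lra.
Qed.

(** As D need not be complete, the outcome is a sequence of approximate representers instead of a
    representer. It is Cauchy: test u_n and u_m against v = u_n - u_m itself. With x, y the two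
    errors and q = [quad f v], one has q <= x + y and x^2, y^2 <= (e/4) q, whence q^2 <= e q. *)
Lemma riesz_approx (phi : V -> R[i]) (M : R) : 0 <= M ->
  (forall a u v, D u -> D v -> phi (u + a *: v) = phi u + Num.conj a * phi v) ->
  (forall v, D v -> rnorm (phi v) ^+ 2 <= M * quad f v) ->
  exists u_ : nat -> V, [/\ forall n, D (u_ n),
    forall n v, D v -> rnorm (f (u_ n) v - phi v) ^+ 2 <= n.+1%:R^-1 * quad f v
    & forall e : R, 0 < e -> exists N, forall n m, (N <= n)%N -> (N <= m)%N ->
        quad f (u_ n - u_ m) <= e].
Proof.
move=> M0 phil phiM.
have h n : exists2 u, D u &
    forall v, D v -> rnorm (f u v - phi v) ^+ 2 <= n.+1%:R^-1 * quad f v.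
  by apply: (riesz_approx1 M0) => //; rewrite invr_gt0 ltr0n.
have {h}[u_ Du hu] : exists2 u_ : nat -> V, forall n, D (u_ n) &
    forall n v, D v -> rnorm (f (u_ n) v - phi v) ^+ 2 <= n.+1%:R^-1 * quad f v.
  by move: h => /(_ _)/cid2-/all_sig2[u_ h1 h2]; exists u_.
exists u_; split => // e e0; have e40 : 0 < e / 4 by lra.
have [N hN] : exists N, N.+1%:R^-1 < e / 4 
  by have [N] := ltr_add_invr e40; rewrite add0r => ?; exists N.
exists N => n m Nn Nm; set v := u_ n - u_ m; have Dv : D v by exact: subspaceB.
have hk k : (N <= k)%N -> rnorm (f (u_ k) v - phi v) ^+ 2 <= e / 4 * quad f v.
  move=> Nk; apply: le_trans (hu k v Dv) _; rewrite ler_wpM2r ?quad_ge0//.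
  by rewrite (le_trans _ (ltW hN))// lef_pV2 ?posrE ?ltr0n// ler_nat.
have := hk n Nn; have := hk m Nm; have q0 := quad_ge0 Dv.
have : quad f v <= rnorm (f (u_ n) v - phi v) + rnorm (f (u_ m) v - phi v).
  apply: le_trans _ (rnormB _ _); apply: le_trans _ (Re_le_rnorm _).
  by rewrite opprB addrA subrK -piBl// lexx.
have := rnorm_ge0 (f (u_ n) v - phi v); have := rnorm_ge0 (f (u_ m) v - phi v).
move: (rnorm _) (rnorm _) (quad f v) q0 => x y q q0 x0 y0 qxy hx hy.
have [->|qn0] := eqVneq q 0; first exact: ltW.
have qp : 0 < q by rewrite lt_neqAle eq_sym qn0.
rewrite -(ler_pM2r qp).
have : (x + y) ^+ 2 <= e * q.
  by have := sqr_ge0 (x - y); rewrite sqrrB sqrrD; lra.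
apply: le_trans; rewrite -expr2 ler_pXn2r ?nnegrE//; lra.
Qed.

Definition orthonormal n (b : 'I_n -> V) :=
  forall i j, f (b i) (b j) = (i == j)%:R.

Lemma lincomb_orthonormal n (b : 'I_n -> V) c j : (forall i, D (b i)) ->
  orthonormal b -> f (lincomb b c) (b j) = c j.
Proof.
move=> Db ob; rewrite pi_lincomb// (bigD1 j)//= ob eqxx mulr1 big1 ?addr0//.
by move=> i /negPf ij; rewrite ob ij mulr0.
Qed.

Lemma orthonormal_indep n (b : 'I_n -> V) : (forall i, D (b i)) ->
  orthonormal b -> forall c, lincomb b c = 0 -> forall i, c i = 0.
Proof.
by move=> Db ob c c0 i; rewrite -(lincomb_orthonormal c i Db ob) c0 pi0l.
Qed.

Definition ortho_proj n (b : 'I_n -> V) u := lincomb b (fun i => f u (b i)).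

Lemma ortho_projP n (b : 'I_n -> V) u : (forall i, D (b i)) -> D u ->
  orthonormal b -> forall v, lin_span b v -> f (u - ortho_proj b u) v = 0.
Proof.
move=> Db Du ob _ [c _ <-].
have Dp : D (ortho_proj b u) by exact: subspace_lincomb.
have Dr : D (u - ortho_proj b u) by exact: subspaceB.
rewrite (pi_herm hf)//; last exact: subspace_lincomb.
rewrite pi_lincomb// big1 ?rmorph0// => i _.
by rewrite (pi_herm hf)// piBl// lincomb_orthonormal// subrr rmorph0 mulr0.
Qed.

Hypothesis f_def : forall u, D u -> quad f u = 0 -> u = 0.

Lemma pnorm_eq0 u : D u -> pnorm f u = 0 -> u = 0.
Proof.
move=> Du u0; apply: f_def => //; rewrite -sqr_pnorm// u0.
by rewrite expr0n.
Qed.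

(** Take an orthonormal family in L of maximal length, which exists because L sits in a span of n
    vectors. If it missed some u, the normalised residual of u could be appended. *)
Lemma ortho_basis L n (g : 'I_n -> V) : lin_subspace L -> L `<=` D ->
  L `<=` lin_span g ->
  exists k (b : 'I_k -> V), orthonormal b /\ lin_span b = L.
Proof.
move=> hL LD Lg.
pose P k := `[< exists b : 'I_k -> V, orthonormal b /\ forall i, L (b i) >].
have P0 : exists k, P k.
  by exists 0%N; apply/asboolP; exists (fun=> 0); split=> -[].
have Pn k : P k -> (k <= n)%N.
  move=> /asboolP[b [ob Lb]]; apply: (@indep_le _ _ _ _ b g) => [i|].
    exact: Lg.
  by apply: orthonormal_indep => // i; exact: LD.
have [k /asboolP[b [ob Lb]] kmax] := ex_maxnP P0 Pn.
have Db i : D (b i) by exact: LD.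
exists k, b; split => //; apply/seteqP; split; first exact: span_sub.
move=> u Lu; apply: contrapT => nu.
pose r := u - ortho_proj b u.
have Lr : L r by apply: subspaceB => //; exact: subspace_lincomb.
have Dr := LD _ Lr; have Du := LD _ Lu.
have r0 : pnorm f r != 0.
  apply/eqP => /pnorm_eq0-/(_ Dr)/eqP; rewrite subr_eq0 => /eqP e.
  by apply: nu; rewrite e; exists (fun i => f u (b i)).
pose e := ((pnorm f r)^-1)%:C *: r.
have De : D e by exact: subspaceZ.
have fre i : f r (b i) = 0 by apply: ortho_projP => //; exact: span_mem.
have feb i : f e (b i) = 0 by rewrite piZl// fre mulr0.
have fee : f e e = 1.
  rewrite quadE// quadZ// rnorm_real -sqr_pnorm//.
  by rewrite ger0_norm ?invr_ge0 ?pnorm_ge0// -exprMn mulVf// expr1n.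
have : P (k + 1)%N.
  apply/asboolP; exists (famcat b (fun _ : 'I_1 => e)); split; last first.
    by apply: famcat_ind => // _; exact: subspaceZ.
  move=> i j; rewrite -(splitK i) -(splitK j) /famcat !unsplitK.
  case: fintype.split => i0; case: fintype.split => j0 /=.
  - by rewrite ob; congr (_%:R); congr nat_of_bool; apply/eqP/eqP => [->//|/lshift_inj].
  - by rewrite (pi_herm hf)// feb rmorph0 eq_lrshift.
  - by rewrite feb eq_rlshift.
  - by rewrite fee !ord1 eqxx.
by move=> /kmax; rewrite addn1 ltnn.
Qed.

End PreInner.
Arguments pre_inner {R V} D f.
Arguments orthonormal {R V} f {n} b.
Arguments ortho_proj {R V} f {n} b u.
(** * Limits and compactness *)

Section Limits.
Context {R : realType} {V : normedModType R[i]}.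

Lemma cvg_rnormP (T : Type) (F : set_system T) {FF : Filter F} (f : T -> V) (l : V) :
  f x @[x --> F] --> l <->
  forall e : R, 0 < e -> \forall x \near F, rnorm (l - f x) < e.
Proof.
split=> [/cvgrPdist_lt h e e0|h].
  have /h : (0 : R[i]) < e%:C by rewrite ltcR.
  by apply: filterS => x; rewrite rnormE ltcR.
apply/cvgrPdist_lt => e e0; have er : e = (Re e)%:C by rewrite RRe_real// gtr0_real.
move: e0; rewrite er -[0]/(0%:C) ltcR => /h; apply: filterS => x.
by rewrite rnormE ltcR.
Qed.

Lemma cvg_rnorm_seqP (f : nat -> V) (l : V) :
  f n @[n --> \oo] --> l <->
  forall e : R, 0 < e -> exists N, forall n, (N <= n)%N -> rnorm (f n - l) < e.
Proof.
rewrite cvg_rnormP; split => h e /h [N].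
  by move=> _ hN; exists N => n /hN; rewrite rdistC.
by move=> hN; exists N => // n /hN; rewrite rdistC.
Qed.

Lemma cvg_approx (u_ : nat -> V) (u : V) (g : nat -> R) :
  (forall n, rnorm (u_ n - u) <= g n) -> g n @[n --> \oo] --> (0 : R) ->
  u_ n @[n --> \oo] --> u.
Proof.
move=> ug g0; apply/cvg_rnorm_seqP => e e0.
have /cvgrPdist_lt/(_ _ e0)[N _ hN] := g0.
exists N => n /hN /=; rewrite sub0r normrN; apply: le_lt_trans.
by rewrite (le_trans (ug n))// ler_norm.
Qed.

Lemma cvg_limE (u_ : nat -> V) (u v : V) :
  u_ n @[n --> \oo] --> u -> u_ n @[n --> \oo] --> v -> u = v.
Proof. exact: (cvg_unique (@norm_hausdorff _ V)). Qed.

Lemma closure_rnormP (S : set V) (u : V) :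
  closure S u -> forall e : R, 0 < e -> exists2 v, S v & rnorm (u - v) < e.
Proof.
move=> clu e e0; have /clu : nbhs u (ball u e%:C).
  by apply: nbhsx_ballx; rewrite ltcR.
by case=> v [Sv]; rewrite -ball_normE/= rnormE ltcR => h; exists v.
Qed.

(* The reindexing phi need not be increasing; phi >= id suffices. *)
Lemma precompact_subseq (S : set V) (x_ : nat -> V) : precompact S ->
  (forall n, S (x_ n)) -> exists (x : V) (phi : nat -> nat),
    (forall n, (n <= phi n)%N) /\ x_ (phi n) @[n --> \oo] --> x.
Proof.
rewrite precompactE => cS Sx.
have [|x [_ clx]] := cS (x_ n @[n --> \oo]) _.
  by exists 0%N => // n _ /=; apply: subset_closure; exact: Sx.
have h n : exists k, (n <= k)%N /\ rnorm (x - x_ k) < n.+1%:R^-1.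
  have h1 : (x_ n @[n --> \oo]) [set x_ k | k in [set k | (n <= k)%N]].
    by exists n => // k /= nk; exists k.
  have h2 : nbhs x (ball x (n.+1%:R^-1)%:C).
    by apply: nbhsx_ballx; rewrite ltcR invr_gt0 ltr0n.
  have [_ [[k nk <-]]] := clx _ _ h1 h2.
  by rewrite -ball_normE/= rnormE ltcR; exists k.
have {h}[phi hphi] := choice h; exists x, phi; split => [n|].
  by have [] := hphi n.
apply: (@cvg_approx _ _ (fun n => n.+1%:R^-1)) => [n|].
  by rewrite rdistC ltW//; have [] := hphi n.
exact: cvg_harmonic.
Qed.

(** The balls centred in S itself already cover the closure of S, so a finite subcover has its
    centres in S. *)
Lemma precompact_net (S : set V) (e : R) : 0 < e -> precompact S ->
  exists n (c : 'I_n -> V), (forall i, S (c i)) /\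
    forall u, S u -> exists i, rnorm (u - c i) < e.
Proof.
move=> e0; rewrite precompactE compact_cover => /(_ V S (fun c => ball c e%:C)).
have e0c : 0 < e%:C :> R[i] by rewrite ltcR.
case=> [c _|u|D DS cov].
- exact: ball_open.
- move=> /closure_rnormP/(_ e e0)[v Sv uv]; exists v => //.
  by rewrite -ball_normE /= rnormE ltcR rdistC.
pose s := finmap.enum_fset D; exists (size s), (fun i => nth 0 s i); split.
  by move=> i; have /(_ s`_i) := DS; rewrite inE; apply; exact: mem_nth.
move=> u /(@subset_closure _ S)/cov[v /= vD].
have vs : v \in s by [].
rewrite -ball_normE /= rnormE ltcR rdistC => h.
have vi : (index v s < size s)%N by rewrite index_mem.
by exists (Ordinal vi); rewrite /= nth_index.
Qed.

(** If no e worked, the radii 1/(n+1) would give families outside O converging to b in every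
    coordinate, hence in the pointwise topology. *)
Lemma ptws_open_rnorm d (O : set {ptws 'I_d -> V}) (b : 'I_d -> V) :
  open O -> O b -> exists2 e : R, 0 < e &
    forall b' : 'I_d -> V, (forall i, rnorm (b i - b' i) < e) -> O b'.
Proof.
move=> oO Ob; apply: contrapT => ne.
have h n : exists b' : 'I_d -> V,
    (forall i, rnorm (b i - b' i) < n.+1%:R^-1) /\ ~ O b'.
  apply: contrapT => nb; apply: ne; exists n.+1%:R^-1.
    by rewrite invr_gt0 ltr0n.
  by move=> b' hb; apply: contrapT => nO; apply: nb; exists b'.
have {h}[b_ hb] := choice h.
have cb : (b_ : nat -> {ptws 'I_d -> V}) n @[n --> \oo] --> (b : {ptws 'I_d -> V}).
  apply/cvg_sup => i U [W] [[W' oW'] <-] W'b WU; apply: filterS WU _.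
  have cbi : b_ n i @[n --> \oo] --> b i.
    apply: (@cvg_approx _ _ (fun n => n.+1%:R^-1)); last exact: cvg_harmonic.
    by move=> n; rewrite rdistC ltW//; have [] := hb n.
  by apply: cbi; exact: open_nbhs_nbhs.
have [N _ hN] : \forall n \near \oo, O (b_ n).
  by apply: cb; exact: open_nbhs_nbhs.
by have [_] := hb N; apply; exact: (hN N (leqnn _)).
Qed.

End Limits.

Lemma cauchy_rnorm (R : realType) (V : completeNormedModType R[i]) (u_ : nat -> V) :
  (forall e : R, 0 < e -> exists N, forall n m, (N <= n)%N -> (N <= m)%N ->
     rnorm (u_ n - u_ m) < e) -> exists u : V, u_ n @[n --> \oo] --> u.
Proof.
move=> h; suff : cvg (u_ n @[n --> \oo]) by move=> c; exists (lim (u_ n @[n --> \oo])).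
apply/cauchy_cvgP; apply: cauchy_exP => e e0.
have er : e = (Re e)%:C by rewrite RRe_real// gtr0_real.
have /h[N hN] : 0 < Re e by move: e0; rewrite {1}er -[0]/(0%:C) ltcR.
exists (u_ N); exists N => // n /= Nn.
by rewrite -ball_normE /= er rnormE ltcR; exact: hN.
Qed.

(** * The inner product of H and its continuity *)

Section Hilbert.
Context {R : realType} {H : completeNormedModType R[i]}.
Context {ip : {dot H for Num.conj}}.
Hypothesis ip_norm : forall u : H, ip u u = `|u| ^+ 2.
Implicit Types u v w : H.

Lemma quad_ip u : quad ip u = rnorm u ^+ 2.
Proof. by rewrite /quad ip_norm rnormE -rmorphXn. Qed.

Lemma ip_pre_inner : pre_inner setT ip.
Proof.
split.
- by [].
- by move=> a u v w _ _ _; rewrite linearPl.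
- by move=> u v _ _; rewrite hermC expr0 mul1r.
- by move=> u _; rewrite -/(quad ip u) quad_ip sqr_ge0.
Qed.

Lemma pnorm_ip u : pnorm ip u = rnorm u.
Proof. by rewrite /pnorm quad_ip sqrtr_sqr ger0_norm ?rnorm_ge0. Qed.

Lemma ip_conj u v : ip u v = Num.conj (ip v u).
Proof. exact: (pi_herm ip_pre_inner). Qed.

Lemma ipDl u v w : ip (u + v) w = ip u w + ip v w.
Proof. exact: (piDl ip_pre_inner). Qed.

Lemma ipBl u v w : ip (u - v) w = ip u w - ip v w.
Proof. exact: (piBl ip_pre_inner). Qed.

Lemma ipZl a u w : ip (a *: u) w = a * ip u w.
Proof. exact: (piZl ip_pre_inner). Qed.

Lemma ipDr u v w : ip w (u + v) = ip w u + ip w v.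
Proof. exact: (piDr ip_pre_inner). Qed.

Lemma ipBr u v w : ip w (u - v) = ip w u - ip w v.
Proof. exact: (piBr ip_pre_inner). Qed.

Lemma ipZr a u w : ip w (a *: u) = Num.conj a * ip w u.
Proof. exact: (piZr ip_pre_inner). Qed.

Lemma ipZr_real (x : R) u w : ip w (x%:C *: u) = x%:C * ip w u.
Proof. by rewrite ipZr -[Num.conj _]/(x%:C^*) conjc_real. Qed.

Lemma ip_real u : ip u u = (rnorm u ^+ 2)%:C.
Proof. by rewrite (quadE ip_pre_inner)// quad_ip. Qed.

Lemma ip_cauchy u v : rnorm (ip u v) <= rnorm u * rnorm v.
Proof. by rewrite -!pnorm_ip (pi_cauchy ip_pre_inner). Qed.

Lemma ip_eq0 u : ip u u = 0 -> u = 0.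
Proof.
rewrite ip_real => -[/eqP]; rewrite sqrf_eq0 => /eqP; exact: rnorm0_eq0.
Qed.

Lemma ip_cvg (T : Type) (F : set_system T) {FF : Filter F} (f g : T -> H) u v :
  f x @[x --> F] --> u -> g x @[x --> F] --> v ->
  ip (f x) (g x) @[x --> F] --> (ip u v : R[i]^o).
Proof.
move=> /cvg_rnormP fu /cvg_rnormP gv.
apply/(cvg_rnormP (V := R[i]^o)) => e e0.
pose M := rnorm u + rnorm v + 1.
have M0 : 0 < M by rewrite /M; have := rnorm_ge0 u; have := rnorm_ge0 v; lra.
pose de := Num.min 1 (e / (2 * M)).
have d0 : 0 < de by rewrite lt_min ltr01 divr_gt0// mulr_gt0.
have := gv _ d0; apply: filter_app; have := fu _ d0; apply: filterS => x.
rewrite !lt_min => /andP[f1 f2] /andP[g1 g2].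
have -> : ip u v - ip (f x) (g x) = ip (u - f x) (g x) + ip u (v - g x).
  by rewrite ipBl ipBr; ring.
apply: le_lt_trans (rnormD _ _) _.
have c1 := ip_cauchy (u - f x) (g x); have c2 := ip_cauchy u (v - g x).
have gx : rnorm (g x) <= rnorm v + 1.
  have := rnormB v (v - g x); rewrite opprB addrC subrK; lra.
move: f2 g2; rewrite !ltr_pdivlMr ?mulr_gt0// => f2 g2.
have := rnorm_ge0 (u - f x); have := rnorm_ge0 (v - g x).
have := rnorm_ge0 u; have := rnorm_ge0 v; have := rnorm_ge0 (g x).
rewrite /M in f2 g2 M0; nra.
Qed.

Lemma ip_cvgl (u_ : nat -> H) u v : u_ n @[n --> \oo] --> u ->
  ip (u_ n) v @[n --> \oo] --> (ip u v : R[i]^o).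
Proof. by move=> h; apply: ip_cvg => //; exact: cvg_cst. Qed.

Lemma ip_cvgr (u_ : nat -> H) u v : u_ n @[n --> \oo] --> u ->
  ip v (u_ n) @[n --> \oo] --> (ip v u : R[i]^o).
Proof. by move=> h; apply: ip_cvg => //; exact: cvg_cst. Qed.

(** Otherwise D contains u with |w - u| < |w|, and |w|^2 = (w - u, w) < |w|^2. *)
Lemma dense_ortho (D : set H) w : dense D -> (forall u, D u -> ip u w = 0) -> w = 0.
Proof.
move=> dD Dw; apply: rnorm0_eq0; apply/eqP; rewrite eq_le rnorm_ge0 andbT.
rewrite leNgt; apply/negP => w0.
have e0 : 0 < (rnorm w)%:C :> R[i] by rewrite ltcR.
have [] := dD (ball w (rnorm w)%:C).
- by exists w; exact: ballxx.
- exact: ball_open.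
move=> u [+ Du]; rewrite -ball_normE /= rnormE ltcR => wu.
have : rnorm w ^+ 2 <= rnorm (w - u) * rnorm w.
  have -> : rnorm w ^+ 2 = Re (ip (w - u) w) by rewrite ipBl (Dw _ Du) subr0 ip_real.
  by rewrite (le_trans (Re_le_rnorm _))// ip_cauchy.
by rewrite expr2 ler_pM2r// leNgt wu.
Qed.

End Hilbert.
(** * The maximal extension and the space E *)

Section AdjointExtension.
Context {R : realType} {H : completeNormedModType R[i]}.
Context {ip : {dot H for Num.conj}}.
Hypothesis ip_norm : forall u : H, ip u u = `|u| ^+ 2.
Context {Ac : operator (H := H)}.
Hypothesis Ac_linear : linear_operator Ac.
Hypothesis Ac_dense : densely_defined Ac.
Hypothesis Ac_sym : symmetric_operator ip Ac.

Local Notation A := (Amax ip Ac).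
Local Notation Dc := (dom Ac).
Local Notation Dmin := (Dmin Ac).
Local Notation Dmax := (Dmax ip Ac).
Local Notation E := (Espace ip Ac).
Local Notation gip := (graph_ip ip A).
Implicit Types u v w x : H.

Lemma adjoint_graph_unique v w1 w2 :
  adjoint_graph ip Ac v w1 -> adjoint_graph ip Ac v w2 -> w1 = w2.
Proof.
move=> h1 h2; apply/eqP; rewrite -subr_eq0; apply/eqP.
apply: (dense_ortho ip_norm Ac_dense) => u Du.
by rewrite (ipBr ip_norm) -h1// -h2// subrr.
Qed.

(** The value of the adjoint is a choice that density makes unique. Values of [A] are computed
    through this lemma. *)
Lemma Amax_intro v w : adjoint_graph ip Ac v w -> Dmax v /\ A v = w.
Proof.
move=> h; split; first by exists w.
rewrite /Amax /adjoint /=; case: xgetP => [w' _ h'|/(_ w)]; last by [].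
exact: adjoint_graph_unique h' h.
Qed.

#[local] Arguments act : simpl never.
#[local] Arguments dom : simpl never.

Lemma Amax_graph v : Dmax v -> adjoint_graph ip Ac v (A v).
Proof. by move=> [w h]; have [_ ->] := Amax_intro h. Qed.

Lemma Ac_Amax u : Dc u -> Dmax u /\ A u = Ac u.
Proof. by move=> Du; apply: Amax_intro => v Dv; exact: Ac_sym. Qed.

Lemma Dc_Dmax : Dc `<=` Dmax.
Proof. by move=> u /Ac_Amax[]. Qed.

Lemma Amax_green u v : Dc u -> Dmax v -> ip (A u) v = ip u (A v).
Proof. by move=> Du Dv; have [_ ->] := Ac_Amax Du; exact: Amax_graph. Qed.

Lemma Amax_linear a u v : Dmax u -> Dmax v ->
  Dmax (a *: u + v) /\ A (a *: u + v) = a *: A u + A v.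
Proof.
move=> Du Dv; apply: Amax_intro => x Dx.
rewrite !(ipDr ip_norm) !(ipZr ip_norm).
by rewrite (Amax_graph Du)// (Amax_graph Dv).
Qed.

Lemma Dmax_subspace : lin_subspace Dmax.
Proof.
split; last by move=> a u v Du Dv; have [] := Amax_linear a Du Dv.
by apply: Dc_Dmax; case: Ac_linear => -[].
Qed.

Lemma AmaxD u v : Dmax u -> Dmax v -> A (u + v) = A u + A v.
Proof.
by move=> Du Dv; have [_] := Amax_linear 1 Du Dv; rewrite !scale1r.
Qed.

Lemma Amax0 : A 0 = 0.
Proof.
have D0 := subspace0 Dmax_subspace.
by have /eqP := AmaxD D0 D0; rewrite addr0 eq_sym -subr_eq0 addrK => /eqP.
Qed.

Lemma AmaxZ a u : Dmax u -> A (a *: u) = a *: A u.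
Proof.
move=> Du; have [_] := Amax_linear a Du (subspace0 Dmax_subspace).
by rewrite addr0 Amax0 addr0.
Qed.

Lemma AmaxN u : Dmax u -> A (- u) = - A u.
Proof. by move=> Du; rewrite -scaleN1r AmaxZ// scaleN1r. Qed.

Lemma AmaxB u v : Dmax u -> Dmax v -> A (u - v) = A u - A v.
Proof.
by move=> Du Dv; rewrite AmaxD ?AmaxN//; exact: subspaceN Dmax_subspace _.
Qed.

Lemma closure_graphP u w : closure (graph Ac) (u, w) <->
  forall e : R, 0 < e -> exists x, [/\ Dc x, rnorm (u - x) < e & rnorm (w - A x) < e].
Proof.
split=> [clu e e0|h P [[P1 P2]/= [/nbhs_ballP[e1 e10 h1] /nbhs_ballP[e2 e20 h2]] PP]].
  have ec : 0 < e%:C :> R[i] by rewrite ltcR.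
  have /clu : nbhs (u, w) (ball u e%:C `*` ball w e%:C).
    by exists (ball u e%:C, ball w e%:C) => //=; split; exact: nbhsx_ballx.
  case=> _ [[x Dx <-]] [/=]; rewrite -!ball_normE /= !rnormE !ltcR => ux wx.
  by exists x; split; rewrite ?(Ac_Amax Dx).2.
have er1 : e1 = (Re e1)%:C by rewrite RRe_real// gtr0_real.
have er2 : e2 = (Re e2)%:C by rewrite RRe_real// gtr0_real.
have /h[x [Dx]] : 0 < Num.min (Re e1) (Re e2).
  by move: e10 e20; rewrite /= er1 er2 -[0]/(0%:C) !ltcR lt_min => -> ->.
rewrite !lt_min => /andP[x1 _] /andP[_ x2].
exists (x, Ac x); split; first by exists x.
have [_ <-] := Ac_Amax Dx.
by apply: PP; split; [apply: h1; rewrite er1|apply: h2; rewrite er2];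
  rewrite -ball_normE /= rnormE ltcR.
Qed.

Lemma Dmin_seqP u w : closure (graph Ac) (u, w) ->
  exists x_ : nat -> H, [/\ forall n, Dc (x_ n), x_ n @[n --> \oo] --> u
    & A (x_ n) @[n --> \oo] --> w].
Proof.
move=> /closure_graphP h.
have {}h n : exists x,
    Dc x /\ rnorm (u - x) < n.+1%:R^-1 /\ rnorm (w - A x) < n.+1%:R^-1.
  by have [|x [*]] := h n.+1%:R^-1; [rewrite invr_gt0 ltr0n|exists x].
have {h}[x_ hx] := choice h; exists x_; split => [n||]; first by have [] := hx n.
  apply: (@cvg_approx _ _ _ _ (fun n => n.+1%:R^-1)); last exact: cvg_harmonic.
  by move=> n; rewrite rdistC ltW//; have [_ []] := hx n.
apply: (@cvg_approx _ _ _ _ (fun n => n.+1%:R^-1)); last exact: cvg_harmonic.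
by move=> n; rewrite rdistC ltW//; have [_ []] := hx n.
Qed.

Lemma Dmax_closed (u_ : nat -> H) u w : (forall n, Dmax (u_ n)) ->
  u_ n @[n --> \oo] --> u -> A (u_ n) @[n --> \oo] --> w -> Dmax u /\ A u = w.
Proof.
move=> Du cu cA; apply: Amax_intro => x Dx.
apply: (@cvg_limE _ R[i]^o (fun n => ip (Ac x) (u_ n))).
  exact: (ip_cvgr ip_norm).
under eq_fun do rewrite (Amax_graph (Du _))//.
exact: (ip_cvgr ip_norm).
Qed.

Lemma Dmin_Amax u w : closure (graph Ac) (u, w) -> Dmax u /\ A u = w.
Proof.
move=> /Dmin_seqP[x_ [Dx cx cA]]; apply: (Dmax_closed (u_ := x_)) => // n.
exact: Dc_Dmax.
Qed.

Lemma Dmin_closure u : Dmin u -> closure (graph Ac) (u, A u).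
Proof. by move=> [w h]; have [_ ->] := Dmin_Amax h. Qed.

Lemma Dmin_Dmax : Dmin `<=` Dmax.
Proof. by move=> u /Dmin_closure/Dmin_Amax[]. Qed.

Lemma Dmin_seq u : Dmin u -> exists x_ : nat -> H, [/\ forall n, Dc (x_ n),
  x_ n @[n --> \oo] --> u & A (x_ n) @[n --> \oo] --> A u].
Proof. by move/Dmin_closure/Dmin_seqP. Qed.

Lemma Dmin_closed (u_ : nat -> H) u w : (forall n, Dmin (u_ n)) ->
  u_ n @[n --> \oo] --> u -> A (u_ n) @[n --> \oo] --> w -> Dmin u /\ A u = w.
Proof.
move=> Du /cvg_rnorm_seqP cu /cvg_rnorm_seqP cA.
suff h : closure (graph Ac) (u, w) by split; [exists w|have [] := Dmin_Amax h].
apply/closure_graphP => e e0; have e20 : 0 < e / 2 by lra.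
have [N1 h1] := cu _ e20; have [N2 h2] := cA _ e20.
set n := maxn N1 N2; have := h1 n (leq_maxl _ _); have := h2 n (leq_maxr _ _).
move: (Dmin_closure (Du n)) => /closure_graphP/(_ _ e20)[x [Dx x1 x2]] h4 h3.
exists x; split=> //.
  have := rnormB (u_ n - x) (u_ n - u); rewrite opprB addrC addrA subrK; lra.
have := rnormB (A (u_ n) - A x) (A (u_ n) - w); rewrite opprB addrC addrA subrK; lra.
Qed.

Lemma Dc_Dmin : Dc `<=` Dmin.
Proof.
move=> u Du; have [] := @Dmin_closed (fun=> u) u (A u) => //; try exact: cvg_cst.
by move=> _; exists (Ac u); apply: subset_closure; exists u.
Qed.

Lemma Dmin_subspace : lin_subspace Dmin.
Proof.
split; first by apply: Dc_Dmin; case: Ac_linear => -[].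
move=> a u v Du Dv.
have [x_ [Dx xu Ax]] := Dmin_seq Du; have [y_ [Dy yv Ay]] := Dmin_seq Dv.
have [|||//] := @Dmin_closed (fun n => a *: x_ n + y_ n) (a *: u + v) (a *: A u + A v).
- by move=> n; apply: Dc_Dmin; case: Ac_linear => -[_ h] _; exact: h.
- by apply: cvgD => //; apply: cvgZl_tmp.
under eq_fun do rewrite (Amax_linear _ (Dc_Dmax (Dx _)) (Dc_Dmax (Dy _))).2.
by apply: cvgD => //; apply: cvgZl_tmp.
Qed.

Lemma Dmin_green u v : Dmin u -> Dmax v -> ip (A u) v = ip u (A v).
Proof.
move=> /Dmin_seq[x_ [Dx cx cA]] Dv.
apply: (@cvg_limE _ R[i]^o (fun n => ip (A (x_ n)) v)).
  exact: (ip_cvgl ip_norm).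
under eq_fun do rewrite Amax_green//.
exact: (ip_cvgl ip_norm).
Qed.

Lemma Dmin_greenr u v : Dmax u -> Dmin v -> ip (A u) v = ip u (A v).
Proof.
move=> Du Dv; rewrite (ip_conj ip_norm) -Dmin_green//.
by rewrite -(ip_conj ip_norm).
Qed.

Lemma quad_gip u : quad gip u = rnorm (A u) ^+ 2 + rnorm u ^+ 2.
Proof. by rewrite /quad /graph_ip ReD -!/(quad ip _) !(quad_ip ip_norm). Qed.

Lemma gip_pre_inner : pre_inner Dmax gip.
Proof.
split.
- exact: Dmax_subspace.
- move=> a u v w Du Dv Dw; rewrite /graph_ip (Amax_linear a Du Dv).2.
  by rewrite !(ipDl ip_norm) !(ipZl ip_norm); ring.
- move=> u v Du Dv; rewrite /graph_ip rmorphD /=.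
  by rewrite -!(ip_conj ip_norm).
- by move=> u Du; rewrite -/(quad gip u) quad_gip addr_ge0 ?sqr_ge0.
Qed.

Lemma rnorm_le_gip u : Dmax u -> rnorm u <= pnorm gip u.
Proof.
move=> Du; rewrite -[leLHS]ger0_norm ?rnorm_ge0// -sqrtr_sqr ler_wsqrtr//.
by rewrite quad_gip lerDr sqr_ge0.
Qed.

Lemma rnormA_le_gip u : Dmax u -> rnorm (A u) <= pnorm gip u.
Proof.
move=> Du; rewrite -[leLHS]ger0_norm ?rnorm_ge0// -sqrtr_sqr ler_wsqrtr//.
by rewrite quad_gip lerDl sqr_ge0.
Qed.

Lemma gip_def u : Dmax u -> quad gip u = 0 -> u = 0.
Proof.
move=> Du /eqP; rewrite quad_gip paddr_eq0 ?sqr_ge0// => /andP[_].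
by rewrite sqrf_eq0 => /eqP/rnorm0_eq0.
Qed.

Lemma Espace_Dmax : E `<=` Dmax. Proof. by move=> u []. Qed.

Lemma Espace_subspace : lin_subspace E.
Proof.
have hD := Dmax_subspace; split.
  split; first exact: subspace0 hD.
  by move=> v /Dmin_Dmax Dv; exact: (pi0l gip_pre_inner).
move=> a u v [Du hu] [Dv hv]; split; first by apply: hD.2.
by move=> w Dw; rewrite (pi_lin gip_pre_inner) ?hu ?hv ?mulr0 ?addr0//; exact: Dmin_Dmax.
Qed.

(* E is the kernel of A^2 + 1, so A acts on E as a complex structure. *)
Lemma Espace_AA u : E u -> Dmax (A u) /\ A (A u) = - u.
Proof.
move=> [Du hu]; apply: Amax_intro => v Dv; have [_ <-] := Ac_Amax Dv.
have := hu v (Dc_Dmin Dv); rewrite /graph_ip => /eqP; rewrite addr_eq0 => /eqP h.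
rewrite -scaleN1r (ipZr ip_norm) rmorphN1 mulN1r (ip_conj ip_norm) h rmorphN /=.
by rewrite -(ip_conj ip_norm).
Qed.

(** For v in D_min, (A u, v)_A = (A A u, A v) + (A u, v) = -(u, A v) + (A u, v), which vanishes by
    Green's formula. *)
Lemma Espace_A u : E u -> E (A u).
Proof.
move=> Eu; have [DA AA] := Espace_AA Eu; split=> // v Dv.
rewrite /graph_ip AA -scaleN1r (ipZl ip_norm) mulN1r.
rewrite (Dmin_greenr _ Dv) ?addNr//; exact: Espace_Dmax.
Qed.

Lemma Espace_Dmin u : E u -> Dmin u -> u = 0.
Proof. by move=> [Du h] mu; apply: gip_def => //; rewrite /quad h. Qed.

(** Approximate representers in D_min of (u, .)_A are Cauchy in the graph norm, so they and their
    images under A converge in H. Closedness puts the limit y in D_min, and e = u - y. *)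
Lemma Dmax_decomp u : Dmax u -> exists2 e, E e & Dmin (u - e).
Proof.
move=> Du; have hD := Dmax_subspace; have hg := gip_pre_inner.
have hm : pre_inner Dmin gip.
  split; first exact: Dmin_subspace.
  - by move=> *; apply: (pi_lin hg); exact: Dmin_Dmax.
  - by move=> *; apply: (pi_herm hg); exact: Dmin_Dmax.
  - by move=> *; apply: (pi_ge0 hg); exact: Dmin_Dmax.
have [|||x_ [Dx hx cx]] := riesz_approx hm (phi := gip u) (M := quad gip u).
- exact: quad_ge0 hg _ _.
- move=> a v w /Dmin_Dmax Dv /Dmin_Dmax Dw; rewrite (piDr hg) ?(piZr hg)//.
  exact: subspaceZ.
- by move=> v /Dmin_Dmax Dv; exact: (pi_cauchy_sqr hg).
have Mx n := Dmin_Dmax (Dx n).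
(* Used for the identity and for A, both dominated by the graph norm. *)
have cau (L : H -> H) :
    (forall n m, rnorm (L (x_ n) - L (x_ m)) ^+ 2 <= quad gip (x_ n - x_ m)) ->
    exists y : H, L (x_ n) @[n --> \oo] --> y.
  move=> hL; apply: cauchy_rnorm => e e0.
  have [|N hN] := cx (e ^+ 2 / 2); first by rewrite divr_gt0// exprn_gt0.
  exists N => n m /hN{}hN /hN{}hN.
  rewrite -(@ltr_pXn2r _ 2)// ?nnegrE ?rnorm_ge0 ?(ltW e0)//.
  have := exprn_gt0 2 e0; have := hL n m; lra.
have [y cy] : exists y : H, x_ n @[n --> \oo] --> y.
  by apply: (cau id) => n m; rewrite quad_gip lerDr sqr_ge0.
have [z cz] : exists z : H, A (x_ n) @[n --> \oo] --> z.
  by apply: (cau A) => n m; rewrite quad_gip AmaxB// lerDl sqr_ge0.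
have [Dy Ay] := Dmin_closed Dx cy cz; have My := Dmin_Dmax Dy.
exists (u - y); last by rewrite opprB addrC subrK.
split=> [|v Dv]; first exact: subspaceB.
have Mv := Dmin_Dmax Dv; rewrite (piBl hg)//; apply/eqP; rewrite subr_eq0; apply/eqP.
apply: (@cvg_limE _ R[i]^o (fun n => gip (x_ n) v)).
  apply/cvg_rnorm_seqP => e e0.
  have q0 : 0 < quad gip v + 1 by have := quad_ge0 hg Mv; lra.
  have d0 : 0 < e ^+ 2 / (quad gip v + 1) by rewrite divr_gt0// exprn_gt0.
  have [N] := ltr_add_invr d0; rewrite add0r => hN.
  exists N => n Nn; rewrite -(@ltr_pXn2r _ 2)// ?nnegrE ?rnorm_ge0 ?(ltW e0)//.
  apply: le_lt_trans (hx n v Dv) _.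
  have : n.+1%:R^-1 < e ^+ 2 / (quad gip v + 1).
    by apply: le_lt_trans hN; rewrite lef_pV2 ?posrE ?ltr0n// ler_nat.
  rewrite ltr_pdivlMr//; apply: le_lt_trans; rewrite ler_wpM2l ?invr_ge0 ?ler0n//; lra.
by rewrite /graph_ip; apply: cvgD; apply: (ip_cvgl ip_norm); rewrite ?Ay.
Qed.

(** [pi_max] is a chosen value. The residual u - e in D_min is orthogonal to E, and two candidates
    differ by a vector of E orthogonal to itself, so the choice is forced. *)
Lemma pi_maxE u e : E e -> Dmin (u - e) -> pi_max ip Ac u = e.
Proof.
move=> Ee De; have hE := Espace_subspace; rewrite /pi_max /graph_proj.
have Mde := Dmin_Dmax De.
have h v : E v -> gip (u - e) v = 0.
  move=> [Dv hv]; rewrite (pi_herm gip_pre_inner)// hv// ?rmorph0//.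
case: xgetP => [e' _ [Ee' he']|/(_ e)]; last by case.
have Eee : E (e - e') by exact: subspaceB.
apply/eqP; rewrite eq_sym -subr_eq0; apply/eqP/gip_def; first by case: Eee.
rewrite /quad; have -> : gip (e - e') (e - e') =
    gip (u - e') (e - e') - gip (u - e) (e - e').
  rewrite -(piBl gip_pre_inner)//; first by
    congr (gip _ _); rewrite opprB [RHS]addrC addrA subrK.
  - have -> : u - e' = (u - e) + (e - e') by rewrite addrA subrK.
    by apply: subspaceD Dmax_subspace _ _ => //; exact: Espace_Dmax.
  - exact: Espace_Dmax.
by rewrite he'// h// subr0.
Qed.

Lemma pi_maxP u : Dmax u -> E (pi_max ip Ac u) /\ Dmin (u - pi_max ip Ac u).
Proof. by move=> /Dmax_decomp[e Ee De]; rewrite (pi_maxE Ee De). Qed.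

Lemma pi_max_linear a u v : Dmax u -> Dmax v ->
  pi_max ip Ac (a *: u + v) = a *: pi_max ip Ac u + pi_max ip Ac v.
Proof.
move=> /pi_maxP[Eu Du] /pi_maxP[Ev Dv]; apply: pi_maxE.
  by apply: Espace_subspace.2.
rewrite opprD addrACA -scalerBr; exact: Dmin_subspace.2.
Qed.

(** The boundary form [u, v]. It vanishes as soon as one argument is in D_min, so it descends to
    D_max / D_min, of which E is a model. *)
Definition omega u v := ip (A u) v - ip u (A v).

Lemma omegaDl u v w : Dmax u -> Dmax v -> omega (u + v) w = omega u w + omega v w.
Proof. by move=> Du Dv; rewrite /omega AmaxD// !(ipDl ip_norm); ring. Qed.

Lemma omegaDr u v w : Dmax u -> Dmax v -> omega w (u + v) = omega w u + omega w v.
Proof. by move=> Du Dv; rewrite /omega AmaxD// !(ipDr ip_norm); ring. Qed.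

Lemma omega_minl u v : Dmin u -> Dmax v -> omega u v = 0.
Proof. by move=> Du Dv; rewrite /omega Dmin_green// subrr. Qed.

Lemma omega_minr u v : Dmax u -> Dmin v -> omega u v = 0.
Proof. by move=> Du Dv; rewrite /omega Dmin_greenr// subrr. Qed.

Lemma omega_pil u v : Dmax u -> Dmax v -> omega (pi_max ip Ac u) v = omega u v.
Proof.
move=> Du Dv; have [Ep Dp] := pi_maxP Du; have Mp := Espace_Dmax Ep.
rewrite -[in RHS](subrK (pi_max ip Ac u) u) omegaDl//; last exact: Dmin_Dmax.
by rewrite (omega_minl Dp Dv) add0r.
Qed.

Lemma omega_pir u v : Dmax u -> Dmax v -> omega v (pi_max ip Ac u) = omega v u.
Proof.
move=> Du Dv; have [Ep Dp] := pi_maxP Du; have Mp := Espace_Dmax Ep.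
rewrite -[in RHS](subrK (pi_max ip Ac u) u) omegaDr//; last exact: Dmin_Dmax.
by rewrite (omega_minr Dv Dp) add0r.
Qed.

Lemma omega_A u r : Dmax u -> E r -> omega u (A r) = gip u r.
Proof.
move=> Du Er; have [_ AA] := Espace_AA Er.
by rewrite /omega /graph_ip AA -(scaleN1r r) (ipZr ip_norm) rmorphN1 mulN1r opprK.
Qed.

(** * Closed range *)

Hypothesis incl_compact : compact_inclusion ip A.

Definition kmin (l : R) : set H := [set u | Dmin u /\ A u = l%:C *: u].
Definition kmax (l : R) : set H := [set u | Dmax u /\ A u = l%:C *: u].

Lemma kmin_kmax l : kmin l `<=` kmax l.
Proof. by move=> u [/Dmin_Dmax]. Qed.

Lemma kmax_subspace l : lin_subspace (kmax l).
Proof.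
split; first by split; [exact: subspace0 Dmax_subspace|rewrite Amax0 scaler0].
move=> a u v [Du Au] [Dv Av]; have [D e] := Amax_linear a Du Dv; split=> //.
by rewrite e Au Av scalerDr !scalerA mulrC.
Qed.

Lemma kmin_subspace l : lin_subspace (kmin l).
Proof.
split; first by split; [exact: subspace0 Dmin_subspace|rewrite Amax0 scaler0].
move=> a u v [Du Au] [Dv Av]; split; first exact: Dmin_subspace.2.
by have [_ ->] := (kmax_subspace l).2 a u v
  (kmin_kmax (conj Du Au)) (kmin_kmax (conj Dv Av)).
Qed.

Lemma gip_unit_ball u : Dmax u -> quad gip u <= 1 ->
  [set u | dom A u /\ gip u u <= 1] u.
Proof. by move=> Du u1; split => //; rewrite (quadE gip_pre_inner)// -[1]/(1%:C) lecR. Qed.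

Lemma gip_bounded_subseq (u_ : nat -> H) (M : R) : 0 <= M ->
  (forall n, Dmax (u_ n)) -> (forall n, quad gip (u_ n) <= M) ->
  exists (x : H) (phi : nat -> nat),
    (forall n, (n <= phi n)%N) /\ u_ (phi n) @[n --> \oo] --> x.
Proof.
(* Compactness concerns the unit ball of the graph norm, and M bounds squared norms. Dividing by M +
   1 suffices as M <= (M + 1)^2, and it avoids both a square root and the case M = 0. *)
move=> M0 Du Mu; pose s := ((M + 1)^-1)%:C : R[i].
have M10 : 0 < M + 1 by lra.
have sn0 : (M + 1)%:C * s = 1 by rewrite -rmorphM /= divff// gt_eqF.
have [n|x [phi [phin cphi]]] := precompact_subseq (x_ := fun n => s *: u_ n) incl_compact.
  apply: gip_unit_ball; first exact: subspaceZ Dmax_subspace _.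
  rewrite (quadZ gip_pre_inner)// rnorm_real ger0_norm ?invr_ge0 ?(ltW M10)//.
  rewrite exprVn mulrC ler_pdivrMr ?exprn_gt0// mul1r.
  by rewrite (le_trans (Mu n))//; nra.
exists ((M + 1)%:C *: x), phi; split => //.
rewrite (_ : (fun n => u_ (phi n)) = fun n => (M + 1)%:C *: (s *: u_ (phi n))).
  by apply: cvgZl_tmp; exact: cphi.
by apply/funext => n; rewrite scalerA sn0 scale1r.
Qed.

Lemma quad_gip_ker l u : kmax l u -> quad gip u = (l ^+ 2 + 1) * rnorm u ^+ 2.
Proof.
move=> [Du Au]; rewrite quad_gip Au rnormZ rnorm_real exprMn.
by rewrite real_normK ?num_real//; ring.
Qed.

(* A net of the unit ball spans: a vector orthogonal to the net stays away
   from it. *)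
Lemma kmin_finite l : exists n (g : 'I_n -> H), kmin l = lin_span g.
Proof.
pose S := [set u | kmin l u /\ quad gip u <= 1].
(* A vector of [kmin l] of graph norm 1 has H-norm 1 / sqrt(l^2 + 1), which exceeds this e. *)
pose e : R := (l ^+ 2 + 2)^-1.
have l0 : 0 <= l ^+ 2 by exact: sqr_ge0.
have e0 : 0 < e by rewrite invr_gt0; lra.
have cS : precompact S.
  apply: precompact_subset incl_compact => u [[Du _] u1].
  by apply: gip_unit_ball => //; exact: Dmin_Dmax.
have [n [c [Sc hc]]] := precompact_net e0 cS.
exists n, c.
have ck i : kmin l (c i) by have [] := Sc i.
have spk : lin_span c `<=` kmin l by exact: span_sub (kmin_subspace l) ck.
apply/seteqP; split => // u ku; apply: contrapT => nu.
have hi := ip_pre_inner ip_norm.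
have [||k [b [ob sb]]] := ortho_basis hi _ (subspace_span c) _
  (subset_refl (A := lin_span c)).
- by move=> v _; rewrite (quad_ip ip_norm) => /eqP; rewrite sqrf_eq0 => /eqP/rnorm0_eq0.
- by [].
pose r := u - ortho_proj ip b u.
have kr : kmin l r.
  apply: subspaceB (kmin_subspace l) ku _; apply: spk; rewrite -sb.
  by exists (fun i => ip u (b i)).
have Mr : Dmax r by apply: Dmin_Dmax; case: kr.
have r0 : pnorm gip r != 0.
  apply/eqP => /(pnorm_eq0 gip_pre_inner gip_def Mr)/eqP; rewrite subr_eq0 => /eqP h.
  by apply: nu; rewrite h -sb; exists (fun i => ip u (b i)).
pose y := ((pnorm gip r)^-1)%:C *: r.
have ky : kmin l y by exact: subspaceZ (kmin_subspace l) _.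
have qy : quad gip y = 1.
  rewrite (quadZ gip_pre_inner)// rnorm_real -(sqr_pnorm gip_pre_inner)//.
  by rewrite ger0_norm ?invr_ge0 ?pnorm_ge0// -exprMn mulVf// expr1n.
have [i hci] : exists i, rnorm (y - c i) < e by apply: hc; rewrite /S /= qy lexx.
have yc : ip y (c i) = 0.
  rewrite (ipZl ip_norm) (ortho_projP hi)// ?mulr0// sb; exact: span_mem.
(* Pythagoras: y is orthogonal to the net, so its distance to c_i is at least |y| > e. *)
have : rnorm y ^+ 2 <= rnorm (y - c i) ^+ 2.
  have -> : rnorm (y - c i) ^+ 2 = rnorm y ^+ 2 + rnorm (c i) ^+ 2.
    rewrite -!(quad_ip ip_norm) /quad (ipBl ip_norm) !(ipBr ip_norm) yc.
    by rewrite (ip_conj ip_norm (c i) y) yc rmorph0 !ReB /=; lra.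
  by rewrite lerDl sqr_ge0.
have := quad_gip_ker (kmin_kmax ky); rewrite qy => h.
have ee : e * (l ^+ 2 + 2) = 1 by rewrite mulVf// gt_eqF//; lra.
have := rnorm_ge0 (y - c i); have := sqr_ge0 (rnorm y).
move: (rnorm (y - c i)) hci (rnorm y ^+ 2) h => x xe q h q0 x0 qx.
have x2 : x ^+ 2 < e ^+ 2 by rewrite ltr_pXn2r// ?nnegrE// ltW.
have : (l ^+ 2 + 1) * e ^+ 2 <= 1.
  have : e <= 1 by rewrite invf_le1; lra.
  by nra.
by nra.
Qed.

Lemma kmin_basis l : exists k (b : 'I_k -> H), orthonormal ip b /\ lin_span b = kmin l.
Proof.
have [n [g eg]] := kmin_finite l.
apply: (ortho_basis (g := g) (ip_pre_inner ip_norm) _ (kmin_subspace l)) => //.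
- by move=> v _; rewrite (quad_ip ip_norm) => /eqP; rewrite sqrf_eq0 => /eqP/rnorm0_eq0.
- by rewrite eg.
Qed.

(** Failure for every C yields unit vectors v_n in D_min, orthogonal to [kmin l], with (A - l) v_n
    -> 0. They are bounded in graph norm, so a subsequence converges in H. Closedness puts its limit
    x in [kmin l], so x is orthogonal to itself although |x| = 1. *)
Lemma bounded_inverse l : exists2 C : R, 0 <= C & forall u, Dmin u ->
  (forall k, kmin l k -> ip u k = 0) -> rnorm u <= C * rnorm (A u - l%:C *: u).
Proof.
apply: contrapT => nC.
have h n : exists u, [/\ Dmin u, forall k, kmin l k -> ip u k = 0, rnorm u = 1
    & rnorm (A u - l%:C *: u) <= n.+1%:R^-1].
  apply: contrapT => nu; apply: nC; exists n.+1%:R => // u Du uk.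
  rewrite leNgt; apply/negP => hu; apply: nu.
  have u0 : 0 < rnorm u by rewrite (le_lt_trans _ hu)// mulr_ge0 ?rnorm_ge0.
  exists ((rnorm u)^-1%:C *: u).
  have ru : rnorm ((rnorm u)^-1%:C : R[i]) = (rnorm u)^-1.
    by rewrite rnorm_real ger0_norm// invr_ge0 ltW.
  split.
  - exact: subspaceZ Dmin_subspace _.
  - by move=> k kk; rewrite (ipZl ip_norm) uk// mulr0.
  - by rewrite rnormZ ru mulVf// gt_eqF.
  rewrite (AmaxZ _ (Dmin_Dmax Du)) scalerA mulrC -scalerA -scalerBr rnormZ ru.
  rewrite mulrC ler_pdivrMr// -(ler_pM2l (ltr0Sn R n)) mulrA mulfV ?mul1r ?ltW//.
  by rewrite pnatr_eq0.
have {h}[v_ hv] := choice h.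
have Dv n : Dmin (v_ n) by have [] := hv n.
have l1 : rnorm (l%:C : R[i]) = `|l| by exact: rnorm_real.
(* The bound comes from |v_n| = 1 and |A v_n| <= |l| + |(A - l) v_n| <= |l| + 1. *)
have [||n|x [phi [phin cphi]]] := @gip_bounded_subseq v_ ((`|l| + 1) ^+ 2 + 1).
- by rewrite addr_ge0 ?sqr_ge0.
- by move=> n; exact: Dmin_Dmax.
- have [_ _ v1 Av] := hv n; rewrite quad_gip v1 expr1n lerD2r.
  rewrite ler_pXn2r ?nnegrE ?rnorm_ge0 ?addr_ge0//.
  rewrite -(subrK (l%:C *: v_ n) (A (v_ n))) (le_trans (rnormD _ _))//.
  rewrite rnormZ l1 v1 mulr1 addrC lerD2l (le_trans Av)//.
  by rewrite invf_le1 ?ltr0n// ler1n.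
have cA : A (v_ (phi n)) @[n --> \oo] --> l%:C *: x.
  rewrite (_ : (fun n => _) =
      fun n => (A (v_ (phi n)) - l%:C *: v_ (phi n)) + l%:C *: v_ (phi n)).
    rewrite -[l%:C *: x]add0r; apply: cvgD; last by apply: cvgZl_tmp.
    apply: (@cvg_approx _ _ _ _ (fun n => n.+1%:R^-1)) => [n|]; last exact: cvg_harmonic.
    rewrite subr0; have [_ _ _ h] := hv (phi n); apply: le_trans h _.
    by rewrite lef_pV2 ?posrE ?ltr0n// ler_nat ltnS phin.
  by apply/funext => n; rewrite subrK.
have [Dx Ax] := Dmin_closed (fun n => Dv (phi n)) cphi cA.
have x0 : ip x x = 0.
  apply: (@cvg_limE _ R[i]^o (fun n => ip (v_ (phi n)) x)).
    exact: (ip_cvgl ip_norm).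
  rewrite (_ : (fun n => _) = fun=> 0); first exact: cvg_cst.
  by apply/funext => n; have [_ h _ _] := hv (phi n); apply: h.
have x1 : ip x x = 1.
  apply: (@cvg_limE _ R[i]^o (fun n => ip (v_ (phi n)) (v_ (phi n)))).
    exact: (ip_cvg ip_norm).
  rewrite (_ : (fun n => _) = fun=> 1); first exact: cvg_cst.
  by apply/funext => n; have [_ _ h _] := hv (phi n); rewrite (ip_real ip_norm) h expr1n.
by have /eqP := x1; rewrite x0 eq_sym oner_eq0.
Qed.

Lemma shift_linear l a u v : Dmax u -> Dmax v ->
  A (a *: u + v) - l%:C *: (a *: u + v) = a *: (A u - l%:C *: u) + (A v - l%:C *: v).
Proof.
move=> Du Dv; rewrite (Amax_linear a Du Dv).2 scalerDr scalerBr !scalerA.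
by rewrite (mulrC l%:C) opprD addrACA.
Qed.

Lemma ker_ortho_shift l u k : Dmin u -> kmax l k -> ip (A u - l%:C *: u) k = 0.
Proof.
move=> Du [Dk Ak]; rewrite (ipBl ip_norm) (Dmin_green Du Dk) Ak (ipZl ip_norm).
by rewrite (ipZr_real ip_norm) subrr.
Qed.

(** Project g onto the range of A_min - l by approximation. The limit y of range elements turns out
    to be g, and [bounded_inverse] makes suitable preimages converge. *)
Lemma closed_range l g : (forall k, kmax l k -> ip g k = 0) ->
  exists2 x, Dmin x & A x - l%:C *: x = g.
Proof.
move=> gk; pose D := [set y | exists2 x, Dmin x & A x - l%:C *: x = y].
have hi := ip_pre_inner ip_norm.
have hD : lin_subspace D.
  split; first by exists 0; [exact: subspace0 Dmin_subspace|rewrite Amax0 scaler0 subr0].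
  move=> a _ _ [x Dx <-] [y Dy <-]; exists (a *: x + y); first exact: Dmin_subspace.2.
  by rewrite shift_linear//; exact: Dmin_Dmax.
have hm : pre_inner D ip.
  by split=> // *; [exact: (pi_lin hi)|exact: (pi_herm hi)|exact: (pi_ge0 hi)].
have [|||y_ [Dy hy cy]] := riesz_approx hm (phi := ip g) (M := quad ip g).
- exact: (quad_ge0 hi).
- by move=> a v w _ _; rewrite (ipDr ip_norm) (ipZr ip_norm).
- by move=> v _; exact: (pi_cauchy_sqr hi).
have ycau (e : R) : 0 < e -> exists N, forall n m, (N <= n)%N -> (N <= m)%N ->
    rnorm (y_ n - y_ m) < e.
  move=> e0; have e20 : 0 < e ^+ 2 by rewrite exprn_gt0.
  have [|N hN] := cy (e ^+ 2 / 2); first by rewrite divr_gt0.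
  exists N => n m Nn Nm; rewrite -(@ltr_pXn2r _ 2)// ?nnegrE ?rnorm_ge0 ?(ltW e0)//.
  have := hN _ _ Nn Nm; rewrite (quad_ip ip_norm); lra.
have [y yy] := cauchy_rnorm ycau.
(* y - g is orthogonal to (A - l) D_c, which says exactly that it is an eigenvector of the adjoint
   or 0. *)
have kyg : kmax l (y - g).
  have h x : Dmin x -> ip (A x - l%:C *: x) (y - g) = 0.
    move=> Dx; set v := A x - _; have Dv : D v by exists x.
    have : ip (y - g) v = 0.
      rewrite (ipBl ip_norm); apply/eqP; rewrite subr_eq0; apply/eqP.
      apply: (@cvg_limE _ R[i]^o (fun n => ip (y_ n) v)); first exact: (ip_cvgl ip_norm).
      apply/cvg_rnorm_seqP => e e0.
      have q0 : 0 < quad ip v + 1 by have := quad_ge0 hm Dv; lra.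
      have d0 : 0 < e ^+ 2 / (quad ip v + 1) by rewrite divr_gt0// exprn_gt0.
      have [N] := ltr_add_invr d0; rewrite add0r => hN.
      exists N => n Nn; rewrite -(@ltr_pXn2r _ 2)// ?nnegrE ?rnorm_ge0 ?(ltW e0)//.
      apply: le_lt_trans (hy n v Dv) _.
      have : n.+1%:R^-1 < e ^+ 2 / (quad ip v + 1).
        by apply: le_lt_trans hN; rewrite lef_pV2 ?posrE ?ltr0n// ler_nat.
      rewrite ltr_pdivlMr//; apply: le_lt_trans; rewrite ler_wpM2l ?invr_ge0 ?ler0n//; lra.
    by move=> h; rewrite (ip_conj ip_norm) h rmorph0.
  apply: Amax_intro => x Dx; rewrite (ipZr_real ip_norm).
  have := h x (Dc_Dmin Dx); rewrite (ipBl ip_norm) (ipZl ip_norm) (Ac_Amax Dx).2.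
  by move=> /eqP; rewrite subr_eq0 => /eqP.
have yk k : kmax l k -> ip y k = 0.
  move=> kk; apply: (@cvg_limE _ R[i]^o (fun n => ip (y_ n) k)).
    exact: (ip_cvgl ip_norm).
  rewrite (_ : (fun n => _) = fun=> 0); first exact: cvg_cst.
  by apply/funext => n; have [x Dx <-] := Dy n; exact: ker_ortho_shift.
(* Both y and g are orthogonal to [kmax l], which contains y - g. *)
have eyg : y = g.
  apply/eqP; rewrite -subr_eq0; apply/eqP/(ip_eq0 ip_norm).
  by rewrite [LHS](ipBl ip_norm) yk// gk// subrr.
have [C C0 hC] := bounded_inverse l; have [k [b [ob sb]]] := kmin_basis l.
(* Preimages are determined only modulo [kmin l]; the part in [kmin l] is removed so that
   [bounded_inverse] applies to their differences. *)
have hx n : exists x, [/\ Dmin x, forall k, kmin l k -> ip x k = 0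
    & A x - l%:C *: x = y_ n].
  have [x Dx ex] := Dy n; pose p := ortho_proj ip b x.
  have kp : kmin l p by rewrite -sb; exists (fun i => ip x (b i)).
  exists (x - p); split.
  - by apply: subspaceB Dmin_subspace Dx _; case: kp.
  - by move=> k0; rewrite -sb => kk; apply: (ortho_projP hi).
  - case: kp => Dp Ap; rewrite (AmaxB (Dmin_Dmax Dx) (Dmin_Dmax Dp)) Ap scalerBr.
    by rewrite -ex opprB addrA subrK.
have {hx}[x_ hx] := choice hx.
have Dx n : Dmin (x_ n) by have [] := hx n.
have [x cx] : exists x : H, x_ n @[n --> \oo] --> x.
  apply: cauchy_rnorm => e e0; have C10 : 0 < C + 1 by lra.
  have [|N hN] := ycau (e / (C + 1)); first by rewrite divr_gt0.
  exists N => n m Nn Nm; have := hN _ _ Nn Nm; rewrite ltr_pdivlMr//.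
  apply: le_lt_trans.
  have [Dn kn <-] := hx n; have [Dm km <-] := hx m.
  have -> : A (x_ n) - l%:C *: x_ n - (A (x_ m) - l%:C *: x_ m) =
      A (x_ n - x_ m) - l%:C *: (x_ n - x_ m).
    rewrite AmaxB; try exact: Dmin_Dmax.
    by rewrite scalerBr !opprB addrACA [RHS]addrACA [in RHS](addrC (- A _)).
  apply: le_trans (hC _ (subspaceB Dmin_subspace Dn Dm) _) _.
    by move=> k0 kk; rewrite (ipBl ip_norm) kn// km// subrr.
  by rewrite mulrC ler_wpM2l ?rnorm_ge0//; lra.
have [Dxx Ax] : Dmin x /\ A x = g + l%:C *: x.
  apply: (Dmin_closed Dx cx).
  rewrite (_ : (fun n => _) = fun n => y_ n + l%:C *: x_ n).
    by rewrite -eyg; apply: cvgD => //; by apply: cvgZl_tmp.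
  by apply/funext => n; have [_ _ <-] := hx n; rewrite subrK.
by exists x => //; rewrite Ax addrK.
Qed.

(** * Lagrangian subspaces and the index *)

Hypothesis Dmin_codim : exists2 n, (0 < n)%N & has_codim Dmin Dmax n.

Lemma Espace_finite : exists n (g : 'I_n -> H), E `<=` lin_span g.
Proof.
have [n _ [b [Db _ bs]]] := Dmin_codim; exists n, (fun i => pi_max ip Ac (b i)).
move=> u Eu; have [c Dc] := bs u (Espace_Dmax Eu); exists c => //.
have EL : E (lincomb (fun i => pi_max ip Ac (b i)) c).
  apply: subspace_lincomb Espace_subspace _ => i.
  by have [] := pi_maxP (Db i).
apply/esym/eqP; rewrite -subr_eq0; apply/eqP/Espace_Dmin.
  exact: subspaceB Espace_subspace _ _.
rewrite -(subrK (lincomb b c) u) -addrA lincombBv.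
apply: subspaceD Dmin_subspace Dc _; apply: subspace_lincomb Dmin_subspace _ => i.
by have [] := pi_maxP (Db i).
Qed.

(** Maximality is stated as equality of L with its annihilator in E, without any dimension: this is
    the form in which solvability of (A - l) x = g delivers it, for K_l as for D_F. *)
Definition lagrangian (L : set H) := [/\ lin_subspace L, L `<=` E,
  forall u v, L u -> L v -> omega u v = 0
  & forall v, E v -> (forall u, L u -> omega u v = 0) -> L v].

Lemma lagrangian_basis L : lagrangian L ->
  exists k (b : 'I_k -> H), orthonormal gip b /\ lin_span b = L.
Proof.
move=> [sL LE _ _]; have [n [g hg]] := Espace_finite.
apply: (ortho_basis (g := g) gip_pre_inner gip_def sL).
  by move=> u /LE/Espace_Dmax.
by move=> u /LE/hg.
Qed.

(** By [u, A r] = (u, r)_A, orthogonality of r to L says that A r is annihilated by L. *)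
Lemma lagrangian_perp L r : lagrangian L -> E r ->
  (forall v, L v -> gip r v = 0) -> L (A r).
Proof.
move=> [sL LE _ hL] Er rL; apply: hL; first exact: Espace_A.
move=> u Lu; have Du := Espace_Dmax (LE _ Lu).
by rewrite omega_A// (pi_herm gip_pre_inner Du (Espace_Dmax Er)) rL// rmorph0.
Qed.

Lemma Amax_lincomb n (b : 'I_n -> H) c : (forall i, Dmax (b i)) ->
  A (lincomb b c) = lincomb (fun i => A (b i)) c.
Proof.
move=> Db; pose P u v := Dmax u /\ A u = v.
suff [] : P (lincomb b c) (lincomb (fun i => A (b i)) c) by [].
rewrite /lincomb; elim/big_ind2: _ => [|u x v y [Du <-] [Dv <-]|i _].
- by split; [exact: subspace0 Dmax_subspace|exact: Amax0].
- by split; [exact: subspaceD Dmax_subspace _ _|exact: AmaxD].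
- by split; [exact: subspaceZ Dmax_subspace _|exact: AmaxZ].
Qed.

(* E is the orthogonal sum of L and A L. *)
Lemma lagrangian_frame L k (b : 'I_k -> H) : lagrangian L -> orthonormal gip b ->
  lin_span b = L ->
  let bb := famcat b (fun i => A (b i)) in
  [/\ forall i, E (bb i), forall c, lincomb bb c = 0 -> forall i, c i = 0
    & E `<=` lin_span bb].
Proof.
move=> lL ob sb bb; have [sL LE Liso _] := lL; have hg := gip_pre_inner.
have Lb i : L (b i) by rewrite -sb; exact: span_mem.
have Eb i : E (b i) by exact: LE.
have Db i : Dmax (b i) by exact: Espace_Dmax.
have bind := orthonormal_indep hg Db ob.
have Lsp c : L (lincomb b c) by rewrite -sb; exists c.
split.
- by apply: famcat_ind => // i; exact: Espace_A.
- move=> c; rewrite lincomb_famcat -Amax_lincomb//.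
  set x := lincomb b _; set y := lincomb b _ => e0.
  have Lx : L x by exact: Lsp.
  have Ly : L y by exact: Lsp.
  have Ey := LE _ Ly; have [DAy AAy] := Espace_AA Ey.
  have Dx := Espace_Dmax (LE _ Lx).
  (* (x, A y)_A = [x, A A y] = -[x, y], and L is isotropic. *)
  have xy : gip x (A y) = 0.
    rewrite -omega_A//; last exact: Espace_A.
    by rewrite AAy Liso//; exact: subspaceN.
  have x0 : x = 0.
    apply: gip_def => //; rewrite /quad.
    have -> : x = - A y by apply/eqP; rewrite -addr_eq0 e0.
    rewrite (piNl hg)//; last exact: subspaceN Dmax_subspace _.
    rewrite (piNr hg)//; have := xy.
    have -> : x = - A y by apply/eqP; rewrite -addr_eq0 e0.
    by rewrite (piNl hg)// => /eqP; rewrite oppr_eq0 => /eqP ->; rewrite !oppr0.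
  have y0 : y = 0.
    have := AAy; have -> : A y = 0 by rewrite -e0 x0 add0r.
    by rewrite Amax0 => /esym/eqP; rewrite oppr_eq0 => /eqP.
  by apply: catc_eq0; [exact: (bind _ x0)|exact: (bind _ y0)].
- move=> e Ee; pose p := ortho_proj gip b e; pose r := e - p.
  have Lp : L p by exact: Lsp.
  have Er : E r by apply: subspaceB Espace_subspace Ee _; exact: LE.
  have LAr : L (A r).
    apply: lagrangian_perp => // v; rewrite -sb; apply: (ortho_projP hg) => //.
    exact: Espace_Dmax.
  (* The residual r is A (- A r) with - A r in L, so it belongs to A L. *)
  have : L (- A r) by exact: subspaceN.
  rewrite -sb => -[c _ ec]; exists (catc (fun i => gip e (b i)) c) => //.
  rewrite lincomb_catc -Amax_lincomb// ec (AmaxN (Espace_Dmax (Espace_A Er))).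
  by rewrite (Espace_AA Er).2 opprK addrC subrK.
Qed.

(** Each doubled family b, A b is a basis of E, so 2k = 2k'. *)
Lemma lagrangian_dim L L' k k' (b : 'I_k -> H) (b' : 'I_k' -> H) :
  lagrangian L -> orthonormal gip b -> lin_span b = L ->
  lagrangian L' -> orthonormal gip b' -> lin_span b' = L' -> k = k'.
Proof.
move=> lL ob sb lL' ob' sb'.
have [Eb ib cb] := lagrangian_frame lL ob sb.
have [Eb' ib' cb'] := lagrangian_frame lL' ob' sb'.
have h1 : (k + k <= k' + k')%N by apply: indep_le ib => i; exact: cb'.
have h2 : (k' + k' <= k + k)%N by apply: indep_le ib' => i; exact: cb.
by apply: double_inj; apply/eqP; rewrite -!addnn eqn_leq h1.
Qed.

(** Isotropy: l is real, so [k, k'] = l (k, k') - l (k, k') = 0. Maximality: if v annihilates K_l,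
    then (A - l) v is orthogonal to ker (A - l), hence equals (A - l) x with x in D_min. Then v - x
    is in that kernel and projects to v. *)
Lemma Kspace_lagrangian l : lagrangian (Kspace ip Ac l).
Proof.
split.
- split; first by exists 0; [exact: subspace0 (kmax_subspace l)|apply: pi_maxE;
    [exact: subspace0 Espace_subspace|rewrite subr0; exact: subspace0 Dmin_subspace]].
  move=> a _ _ [u ku <-] [v kv <-]; exists (a *: u + v).
    exact: (kmax_subspace l).2.
  by apply: pi_max_linear; [case: ku|case: kv].
- by move=> _ [u [Du _] <-]; have [] := pi_maxP Du.
- move=> _ _ [u [Du Au] <-] [v [Dv Av] <-].
  rewrite omega_pil//; last by apply: Espace_Dmax; have [] := pi_maxP Dv.
  by rewrite omega_pir// /omega Au Av (ipZl ip_norm) (ipZr_real ip_norm) subrr.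
- move=> v Ev hv; have Dv := Espace_Dmax Ev.
  have [k [Dk Ak]|x Dx ex] := @closed_range l (A v - l%:C *: v).
    have : omega (pi_max ip Ac k) v = 0 by apply: hv; exists k.
    rewrite omega_pil// /omega Ak (ipZl ip_norm) -(ipZr_real ip_norm) => h.
    rewrite (ip_conj ip_norm) (ipBr ip_norm); move/eqP: h; rewrite subr_eq0 => /eqP ->.
    by rewrite subrr rmorph0.
  have Mx := Dmin_Dmax Dx.
  exists (v - x); last by apply: pi_maxE => //; rewrite addrAC subrr add0r;
    exact: subspaceN Dmin_subspace _.
  split; first exact: subspaceB Dmax_subspace _ _.
  rewrite -[RHS]/(l%:C *: (v - x)) -[LHS]/(A (v - x)) AmaxB// scalerBr.
  apply/eqP; rewrite subr_eq -addrA [- _ + _]addrC ex addrC subrK.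
  exact: eqxx.
Qed.

(** A basis b0 of ker A_min (q vectors) and lifts c of a basis b of K_0 (k vectors) together form a
    basis of ker A_max. The range of A_min is the orthogonal complement of ker A_max, so its
    codimension is q + k and the index is q - (q + k) = -k. *)
Lemma index_Kspace0 (d : nat) : d%:Z = - fredholm_index (Amin ip Ac) ->
  exists b : 'I_d -> H, orthonormal gip b /\ lin_span b = Kspace ip Ac 0.
Proof.
have [k [b [ob sb]]] := lagrangian_basis (Kspace_lagrangian 0).
have [q [b0 [ob0 sb0]]] := kmin_basis 0.
have hi := ip_pre_inner ip_norm; have hg := gip_pre_inner.
have KE := let: And4 _ h _ _ := Kspace_lagrangian 0 in h.
have Kb i : Kspace ip Ac 0 (b i) by rewrite -sb; exact: span_mem.
have Eb i : E (b i) by exact: KE.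
have bind := orthonormal_indep hg (fun i => Espace_Dmax (Eb i)) ob.
have b0ind := orthonormal_indep hi (D := setT) (fun=> I) ob0.
have {Kb} /choice[c hc] : forall i, exists u, kmax 0 u /\ pi_max ip Ac u = b i.
  by move=> i; have [u ku e] := Kb i; exists u.
have kc i : kmax 0 (c i) by have [] := hc i.
have cb i : Dmin (c i - b i).
  by have [[Du _] <-] := hc i; have [] := pi_maxP Du.
have kb0 i : kmin 0 (b0 i) by rewrite -sb0; exact: span_mem.
pose g := famcat b0 c.
have kg i : kmax 0 (g i) by apply: famcat_ind => // j; exact: kmin_kmax.
have k0sub := kmax_subspace 0.
have kmaxg : kmax 0 = lin_span g.
  apply/seteqP; split; last exact: span_sub.
  move=> u ku; have [Du _] := ku; have [Eu Dpu] := pi_maxP Du.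
  have : Kspace ip Ac 0 (pi_max ip Ac u) by exists u.
  rewrite -sb => -[c2 _ e2].
  have : kmin 0 (u - lincomb c c2).
    have [Dk Ak] : kmax 0 (u - lincomb c c2).
      by apply: subspaceB => //; exact: subspace_lincomb.
    split=> //; rewrite -(subrK (lincomb b c2) u) -addrA lincombBv.
    apply: subspaceD Dmin_subspace _ _; first by rewrite e2.
    apply: subspace_lincomb Dmin_subspace _ => i.
    by rewrite -opprB; exact: subspaceN Dmin_subspace _.
  rewrite -sb0 => -[c1 _ e1]; exists (catc c1 c2) => //.
  by rewrite lincomb_catc e1 subrK.
pose W := act (Amin ip Ac) @` dom (Amin ip Ac).
have WE w : W w <-> exists2 x, Dmin x & A x - 0%:C *: x = w.
  split=> -[x Dx <-]; exists x => //; first by rewrite scale0r subr0.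
  by rewrite scale0r subr0.
have sW : lin_subspace W.
  split; first by exists 0; [exact: subspace0 Dmin_subspace|exact: Amax0].
  move=> a _ _ [x Dx <-] [y Dy <-]; exists (a *: x + y).
    exact: Dmin_subspace.2.
  by rewrite -[LHS]/(A _) (Amax_linear a (Dmin_Dmax Dx) (Dmin_Dmax Dy)).2.
(* Independence: a kernel vector in the range is orthogonal to itself. Spanning: u minus its
   projection onto ker A_max satisfies the condition of [closed_range]. *)
have cW : has_codim W setT (q + k)%N.
  exists g; split => // [c' /WE[x Dx ex]|u _].
  - have kgc : kmax 0 (lincomb g c') by exact: subspace_lincomb.
    have g0 : lincomb g c' = 0.
      by apply: (ip_eq0 ip_norm); rewrite -{1}ex; exact: ker_ortho_shift.
    move: g0; rewrite lincomb_famcat; set c1 := fun i => _; set c2 := fun i => _ => g0.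
    have Db0 : Dmin (lincomb b0 c1).
      by apply: subspace_lincomb Dmin_subspace _ => i; have [] := kb0 i.
    have c20 : lincomb b c2 = 0.
      apply: Espace_Dmin; first exact: subspace_lincomb Espace_subspace _.
      have -> : lincomb b c2 = lincomb c c2 - lincomb (fun i => c i - b i) c2.
        by rewrite -lincombBv opprB addrC subrK.
      apply: subspaceB Dmin_subspace _ _; last exact: subspace_lincomb Dmin_subspace _.
      have -> : lincomb c c2 = - lincomb b0 c1 by apply/eqP; rewrite -addr_eq0 addrC g0.
      exact: subspaceN Dmin_subspace _.
    have c2z := bind _ c20.
    have c10 : lincomb b0 c1 = 0.
      by move: g0; rewrite [lincomb c c2]big1 ?addr0// => i _; rewrite c2z scale0r.
    by apply: catc_eq0 => // i; exact: (b0ind _ c10).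
  - have [|||k1 [b1 [ob1 sb1]]] := ortho_basis (L := kmax 0) (g := g) hi _ k0sub _ _.
    + by move=> v _; rewrite (quad_ip ip_norm) => /eqP; rewrite sqrf_eq0 => /eqP/rnorm0_eq0.
    + by [].
    + by rewrite kmaxg.
    have : lin_span g (ortho_proj ip b1 u).
      by rewrite -kmaxg -sb1; exists (fun i => ip u (b1 i)).
    move=> [c' _ e']; exists c'; apply/WE; apply: closed_range => v kv.
    by rewrite e'; apply: (ortho_projP hi) => //; rewrite sb1.
have cK : has_codim [set 0] (kmin 0) q.
  exists b0; split=> // u; rewrite -sb0 => -[c' _ <-].
  by exists c'; rewrite /= subrr.
have e1 : Defs.dim (op_kernel (Amin ip Ac) 0) = q by exact: (codimE (subspace_set0) cK).
have e2 : codim W setT = (q + k)%N by exact: codimE.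
rewrite /fredholm_index -/W e1 e2 PoszD opprB addrAC subrr add0r => -[->].
by exists b.
Qed.

(** * The Friedrichs extension *)

Context {l0 : R}.
Hypothesis Ac_below : forall u : H, Dc u -> (l0 + 1)%:C * `|u| ^+ 2 <= ip (Ac u) u.

Lemma cvg_Re_ge0 (z_ : nat -> R[i]) (z : R[i]) :
  z_ n @[n --> \oo] --> (z : R[i]^o) -> (forall n, 0 <= Re (z_ n)) -> 0 <= Re z.
Proof.
move=> /(cvg_rnorm_seqP (V := R[i]^o)) h z0; rewrite leNgt; apply/negP => zn.
have e0 : 0 < - Re z by lra.
have [N /(_ N (leqnn _)) hN] := h _ e0.
have := le_lt_trans (Re_le_rnorm _) hN; rewrite ReB; have := z0 N; lra.
Qed.

Lemma Dmin_below u : Dmin u -> (l0 + 1) * rnorm u ^+ 2 <= Re (ip (A u) u).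
Proof.
move=> /Dmin_seq[x_ [Dx xu Ax]]; rewrite -subr_ge0.
have -> : Re (ip (A u) u) - (l0 + 1) * rnorm u ^+ 2 =
    Re (ip (A u - (l0 + 1)%:C *: u) u).
  by rewrite (ipBl ip_norm) (ipZl ip_norm) ReB ReZ (ip_real ip_norm).
apply: (@cvg_Re_ge0 (fun n => ip (A (x_ n) - (l0 + 1)%:C *: x_ n) (x_ n))) => [|n].
  by apply: (ip_cvg ip_norm) => //; apply: cvgB => //; apply: cvgZl_tmp.
rewrite (ipBl ip_norm) (ipZl ip_norm) ReB ReZ (ip_real ip_norm) subr_ge0 /=.
have := Ac_below (Dx n); rewrite (Ac_Amax (Dx n)).2 rnormE -rmorphXn -rmorphM /=.
by rewrite lecE => /andP[].
Qed.

(** The shift l0 lies one below a lower bound of A_c, so this form is positive and its square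
    dominates |u|^2: form convergence entails convergence in H. *)
Definition tform u v := ip (A u) v - l0%:C * ip u v.

Lemma tformE u v : tform u v = ip (A u - l0%:C *: u) v.
Proof. by rewrite (ipBl ip_norm) (ipZl ip_norm). Qed.

Lemma quad_tform u : quad tform u = Re (ip (A u) u) - l0 * rnorm u ^+ 2.
Proof. by rewrite /quad /tform ReB ReZ (ip_real ip_norm). Qed.

Lemma quad_tform_ge u : Dmin u -> rnorm u ^+ 2 <= quad tform u.
Proof. by move=> /Dmin_below; rewrite quad_tform; lra. Qed.

Lemma tform_pre_inner : pre_inner Dmin tform.
Proof.
split.
- exact: Dmin_subspace.
- move=> a u v w /Dmin_Dmax Du /Dmin_Dmax Dv _; rewrite /tform (Amax_linear a Du Dv).2.
  by rewrite !(ipDl ip_norm) !(ipZl ip_norm); ring.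
- move=> u v Du Dv; rewrite /tform (Dmin_green Du (Dmin_Dmax Dv)) rmorphB rmorphM /=.
  by rewrite -!(ip_conj ip_norm) -[Num.conj _]/(l0%:C^*) conjc_real.
- by move=> u Du; rewrite -/(quad tform u) (le_trans (sqr_ge0 (rnorm u)))// quad_tform_ge.
Qed.
Let ht := tform_pre_inner.

Lemma rnorm_le_tform u : Dmin u -> rnorm u <= pnorm tform u.
Proof.
move=> Du; rewrite -[leLHS]ger0_norm ?rnorm_ge0// -sqrtr_sqr ler_wsqrtr//.
exact: quad_tform_ge.
Qed.

Definition tform_cauchy (u_ : nat -> H) := forall e : R, 0 < e ->
  exists N, forall n k, (N <= n)%N -> (N <= k)%N -> quad tform (u_ n - u_ k) <= e.

Lemma DcB u v : Dc u -> Dc v -> Dc (u - v).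
Proof. by case: Ac_linear => hD _; exact: subspaceB. Qed.

(** The form (A_c u, u) may be indefinite. Along a sequence converging in H the terms l0 |u_n -
    u_k|^2 tend to 0, so the Cauchy condition may be read with the positive form [tform]. *)
Lemma form_cvgP (u_ : nat -> H) u : form_cvg ip Ac u_ u <->
  [/\ forall n, Dc (u_ n), u_ n @[n --> \oo] --> u & tform_cauchy u_].
Proof.
split=> -[Du cu ch]; split=> //.
- move=> e e0.
  have /(cvg_rnormP (V := R[i]^o))/(_ (e / 2)) := ch.
  case=> [|[P1 P2] /= [[N1 _ h1] [N2 _ h2]] hP]; first by lra.
  have d0 : 0 < e / (8 * (`|l0| + 1)).
    by rewrite divr_gt0 ?mulr_gt0//; have := normr_ge0 l0; lra.
  (* |u_n - u_k| < 2 s and s <= 1 give |u_n - u_k|^2 <= 4 s, hence an l0-term of at most e/2. *)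
  pose s := Num.min 1 (e / (8 * (`|l0| + 1))).
  have s0 : 0 < s by rewrite lt_min ltr01.
  have /cvg_rnorm_seqP/(_ _ s0)[N3 h3] := cu.
  exists (maxn N1 (maxn N2 N3)) => n k; rewrite !geq_max => /and3P[n1 n2 n3] /and3P[k1 k2 k3].
  have := hP (n, k) (conj (h1 n n1) (h2 k k2)); rewrite /= sub0r rnormN => hnk.
  have Dnk := DcB (Du n) (Du k).
  rewrite quad_tform (Ac_Amax Dnk).2.
  have := le_lt_trans (Re_le_rnorm _) hnk.
  have xb : rnorm (u_ n - u_ k) < 2 * s.
    have := rnormB (u_ n - u) (u_ k - u); rewrite opprB addrA subrK.
    have := h3 n n3; have := h3 k k3; lra.
  have s1 : s <= 1 by rewrite ge_min lexx.
  have s2 : s * (8 * (`|l0| + 1)) <= e.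
    by rewrite -ler_pdivlMr ?ge_min ?lexx ?orbT// mulr_gt0//; have := normr_ge0 l0; lra.
  have x2 : rnorm (u_ n - u_ k) ^+ 2 <= 4 * s.
    have := rnorm_ge0 (u_ n - u_ k); nra.
  have l2 : - l0 * rnorm (u_ n - u_ k) ^+ 2 <= `|l0| * (4 * s).
    have : - l0 <= `|l0| by rewrite lerNl lerNnormlW.
    have := sqr_ge0 (rnorm (u_ n - u_ k)); have := normr_ge0 l0; nra.
  have := normr_ge0 l0; nra.
- apply/(cvg_rnormP (V := R[i]^o)) => e e0.
  have d0 : 0 < e / (2 * (`|l0| + 1)).
    by rewrite divr_gt0 ?mulr_gt0//; have := normr_ge0 l0; lra.
  have [N hN] := ch _ d0.
  exists ([set n | (N <= n)%N], [set n | (N <= n)%N]); first by split; exists N.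
  move=> [n k] /= [Nn Nk]; rewrite sub0r rnormN.
  have Dnk := DcB (Du n) (Du k); have Mnk := Dc_Dmin Dnk.
  rewrite -(Ac_Amax Dnk).2.
  have -> : ip (A (u_ n - u_ k)) (u_ n - u_ k) =
      tform (u_ n - u_ k) (u_ n - u_ k) + (l0 * rnorm (u_ n - u_ k) ^+ 2)%:C.
    by rewrite /tform (ip_real ip_norm) -rmorphM subrK.
  have := hN n k Nn Nk; rewrite ler_pdivlMr; last first.
    by rewrite mulr_gt0//; have := normr_ge0 l0; lra.
  have := quad_tform_ge Mnk; rewrite (quadE ht Mnk) -rmorphD rnorm_real.
  have q0 := quad_ge0 ht Mnk; move=> qx.
  move=> hq; apply: le_lt_trans (ler_normD _ _) _; rewrite normrM.
  rewrite (ger0_norm q0) (ger0_norm (sqr_ge0 _)).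
  have := normr_ge0 l0; nra.
Qed.

Lemma tform_cauchyB (u_ v_ : nat -> H) :
  (forall n, Dmin (u_ n)) -> (forall n, Dmin (v_ n)) ->
  tform_cauchy u_ -> tform_cauchy v_ -> tform_cauchy (fun n => u_ n - v_ n).
Proof.
move=> Du Dv cu cv e e0; have e40 : 0 < e / 4 by lra.
have [N1 h1] := cu _ e40; have [N2 h2] := cv _ e40.
exists (maxn N1 N2) => n k; rewrite !geq_max => /andP[n1 n2] /andP[k1 k2].
have -> : u_ n - v_ n - (u_ k - v_ k) = (u_ n - u_ k) - (v_ n - v_ k).
  by rewrite !opprB addrACA [RHS]addrACA [in RHS](addrC (- u_ k)).
have hD := Dmin_subspace.
have Du' : Dmin (u_ n - u_ k) by exact: subspaceB.
have Dv' : Dmin (v_ n - v_ k) by exact: subspaceB.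
rewrite -(sqr_pnorm ht); last exact: subspaceB.
have := pnormB ht Du' Dv'; have := pnorm_ge0 (f := tform) (u_ n - u_ k - (v_ n - v_ k)).
have := h1 n k n1 k1; have := h2 n k n2 k2.
rewrite -!(sqr_pnorm ht)//.
move: (pnorm _ _) (pnorm _ _) (pnorm _ _) => x y z hz hy x0 xyz.
apply: (@le_trans _ _ ((y + z) ^+ 2)).
  by rewrite ler_pXn2r ?nnegrE//; apply: le_trans x0 xyz.
have := sqr_ge0 (y - z); nra.
Qed.

(** Split t(z_n, z_n) = t(z_n, z_n - z_k) + t(z_n, z_k). For fixed n the last term is ((A - l0) z_n,
    z_k), which tends to 0 with z_k; the other is small by Cauchy-Schwarz and the Cauchy property.
    Hence form limits do not depend on the approximating sequence. *)
Lemma tform_closable (z_ : nat -> H) : (forall n, Dmin (z_ n)) -> tform_cauchy z_ ->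
  z_ n @[n --> \oo] --> (0 : H) ->
  forall e : R, 0 < e -> exists N, forall n, (N <= n)%N -> quad tform (z_ n) <= e.
Proof.
move=> Dz cz z0 e e0; have e40 : 0 < e / 4 by lra.
have [N hN] := cz _ e40; exists N => n Nn.
set q := quad tform (z_ n); rewrite leNgt; apply/negP => qe.
have q0 : 0 < q by lra.
set w := A (z_ n) - l0%:C *: z_ n.
have rw : 0 < rnorm w + 1 by have := rnorm_ge0 w; lra.
have d0 : 0 < q / 2 / (rnorm w + 1) by rewrite !divr_gt0.
have /cvg_rnorm_seqP/(_ _ d0)[N' hN'] := z0.
set k := maxn N N'; have kN : (N <= k)%N by exact: leq_maxl.
have := hN' k (leq_maxr _ _); rewrite subr0 ltr_pdivlMr// => zk.
have Dnk : Dmin (z_ n - z_ k) by exact: subspaceB Dmin_subspace _ _.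
have h1 := pi_cauchy_sqr ht (Dz n) Dnk.
have h2 : rnorm (tform (z_ n) (z_ k)) <= q / 2.
  rewrite tformE -/w (le_trans (ip_cauchy ip_norm _ _))//.
  have := rnorm_ge0 (z_ k); nra.
have h3 : q <= rnorm (tform (z_ n) (z_ n - z_ k)) + rnorm (tform (z_ n) (z_ k)).
  apply: le_trans _ (rnormD _ _); apply: le_trans _ (Re_le_rnorm _).
  by rewrite (piBr ht)// subrK.
have h4 := hN n k Nn kN; have h5 := rnorm_ge0 (tform (z_ n) (z_ n - z_ k)).
rewrite -/q in h1; have := quad_ge0 ht Dnk.
move: (rnorm _) (rnorm _) (quad tform (z_ n - z_ k)) h1 h2 h3 h4 h5.
move=> y x p h1 h2 h3 h4 h5 p0.
have : (q / 2) ^+ 2 <= x ^+ 2 by rewrite ler_pXn2r ?nnegrE//; lra.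
nra.
Qed.

Lemma tform_bounded (v_ : nat -> H) : (forall n, Dmin (v_ n)) -> tform_cauchy v_ ->
  exists N (M : R), forall n, (N <= n)%N -> quad tform (v_ n) <= M.
Proof.
move=> Dv /(_ 1 ltr01)[N hN]; exists N, ((pnorm tform (v_ N) + 1) ^+ 2) => n Nn.
have Dn : Dmin (v_ n - v_ N) by exact: subspaceB Dmin_subspace _ _.
rewrite -(sqr_pnorm ht)// ler_pXn2r ?nnegrE ?pnorm_ge0 ?addr_ge0 ?pnorm_ge0//.
rewrite -[v_ n](subrK (v_ N)) addrC (le_trans (pnormD ht _ _))// lerD2l.
rewrite -(@ler_pXn2r _ 2)// ?nnegrE ?pnorm_ge0// (sqr_pnorm ht)// expr1n.
exact: hN.
Qed.

Lemma form_cvg_cst v : Dc v -> form_cvg ip Ac (fun=> v) v.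
Proof.
move=> Dv; apply/form_cvgP; split=> //; first exact: cvg_cst.
move=> e e0; exists 0%N => n k _ _; rewrite subrr /quad (pi0l ht) ?ltW//.
exact: subspace0 Dmin_subspace.
Qed.

Lemma form_cvg_dom (u_ : nat -> H) u : form_cvg ip Ac u_ u -> form_dom ip Ac u.
Proof. by move=> h; exists u_. Qed.

Local Notation Fdom := (friedrichs_dom ip Ac).

(** Testing the form relation against x in D_c, as a constant sequence, gives (u, A_c x) = (w, x):
    the Friedrichs operator is a restriction of A, and its value w is A u. *)
Lemma friedrichs_Dmax u : Fdom u ->
  Dmax u /\ forall v, form_dom ip Ac v -> closed_form ip Ac u v (ip (A u) v).
Proof.
move=> [[u_ cu] [w hw]].
have [Du Au] : Dmax u /\ A u = w.
  apply: Amax_intro => x Dx.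
  have := hw x (form_cvg_dom (form_cvg_cst Dx)) u_ _ cu (form_cvg_cst Dx).
  move: cu => /form_cvgP[Du cu _] h.
  have h' : ip (u_ n) (Ac x) @[n --> \oo] --> (ip w x : R[i]^o).
    rewrite (_ : (fun n => _) = fun n => ip (Ac (u_ n)) x) //.
    by apply/funext => n; rewrite Ac_sym.
  have := cvg_limE (V := R[i]^o) h' (ip_cvgl ip_norm cu) => e.
  by rewrite (ip_conj ip_norm) -e -(ip_conj ip_norm).
by rewrite -Au in hw; split; [exact: Du|exact: hw].
Qed.

Lemma cvg_conj (z_ : nat -> R[i]) (z : R[i]) : z_ n @[n --> \oo] --> (z : R[i]^o) ->
  Num.conj (z_ n) @[n --> \oo] --> (Num.conj z : R[i]^o).
Proof.
move=> /(cvg_rnorm_seqP (V := R[i]^o)) h.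
apply/(cvg_rnorm_seqP (V := R[i]^o)) => e /h[N hN].
by exists N => n /hN; rewrite -rmorphB rnorm_conj.
Qed.

Lemma cvg_add0 (r_ z_ : nat -> R[i]) (z : R[i]) :
  r_ n @[n --> \oo] --> (0 : R[i]^o) -> z_ n @[n --> \oo] --> (z : R[i]^o) ->
  r_ n + z_ n @[n --> \oo] --> (z : R[i]^o).
Proof.
move=> /(cvg_rnorm_seqP (V := R[i]^o)) hr /(cvg_rnorm_seqP (V := R[i]^o)) hz.
apply/(cvg_rnorm_seqP (V := R[i]^o)) => e e0; have e20 : 0 < e / 2 by lra.
have [N1 h1] := hr _ e20; have [N2 h2] := hz _ e20.
exists (maxn N1 N2) => n; rewrite geq_max => /andP[/h1 + /h2].
by rewrite subr0 -addrA => h3 h4; apply: le_lt_trans (rnormD _ _) _; lra.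
Qed.

(** By symmetry of A_c, one numerical sequence (A_c u_n, v_n) has both (A u, v) and (u, A v) as
    limit. *)
Lemma friedrichs_isotropic u v : Fdom u -> Fdom v -> omega u v = 0.
Proof.
move=> Fu Fv; have [Du hu] := friedrichs_Dmax Fu; have [Dv hv] := friedrichs_Dmax Fv.
have [[u_ cu] _] := Fu; have [[v_ cv] _] := Fv.
have h1 := hu v (form_cvg_dom cv) _ _ cu cv.
have h2 := hv u (form_cvg_dom cu) _ _ cv cu.
rewrite /omega (ip_conj ip_norm u); apply/eqP; rewrite subr_eq0; apply/eqP.
apply: (cvg_limE (V := R[i]^o) h1); move/cvg_conj: h2.
rewrite (_ : (fun n => Num.conj _) = fun n => ip (Ac (u_ n)) (v_ n)) //.
move: cu cv => /form_cvgP[cu _ _] /form_cvgP[cv _ _].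
by apply/funext => n; rewrite (Ac_sym (cu n) (cv n)) (ip_conj ip_norm (u_ n)).
Qed.

(** Riesz for the shifted form on D_c: approximate representers u_n of (g, .) are form Cauchy, and
    their limit u satisfies t(u, v) = (g, v). *)
Lemma friedrichs_surj g : exists2 u, Fdom u & A u - l0%:C *: u = g.
Proof.
have hc : pre_inner Dc tform.
  split; first by case: Ac_linear.
  - by move=> *; apply: (pi_lin ht); exact: Dc_Dmin.
  - by move=> *; apply: (pi_herm ht); exact: Dc_Dmin.
  - by move=> *; apply: (pi_ge0 ht); exact: Dc_Dmin.
have [|||u_ [Du hu cu]] := riesz_approx hc (phi := ip g) (M := rnorm g ^+ 2).
- exact: sqr_ge0.
- by move=> a v w _ _; rewrite (ipDr ip_norm) (ipZr ip_norm).
- move=> v Dv; have := ip_cauchy ip_norm g v.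
  have := quad_tform_ge (Dc_Dmin Dv); move=> h1 h2.
  apply: (@le_trans _ _ ((rnorm g * rnorm v) ^+ 2)).
    by rewrite ler_pXn2r ?nnegrE ?mulr_ge0 ?rnorm_ge0.
  by rewrite exprMn ler_wpM2l ?sqr_ge0.
have Mu n := Dc_Dmin (Du n).
have [u uu] : exists u : H, u_ n @[n --> \oo] --> u.
  apply: cauchy_rnorm => e e0; have e20 : 0 < e ^+ 2 by rewrite exprn_gt0.
  have [|N hN] := cu (e ^+ 2 / 2); first by rewrite divr_gt0.
  exists N => n k Nn Nk; rewrite -(@ltr_pXn2r _ 2)// ?nnegrE ?rnorm_ge0 ?(ltW e0)//.
  have := hN _ _ Nn Nk.
  have := quad_tform_ge (Dc_Dmin (DcB (Du n) (Du k))); lra.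
have fu : form_cvg ip Ac u_ u by apply/form_cvgP.
have Fu : Fdom u /\
    forall v, form_dom ip Ac v -> closed_form ip Ac u v (ip (g + l0%:C *: u) v).
  suff h : forall v, form_dom ip Ac v -> closed_form ip Ac u v (ip (g + l0%:C *: u) v).
    by split=> //; split; [exists u_|exists (g + l0%:C *: u)].
  move=> v _ u' v' /form_cvgP[Du' u'u cu'] /form_cvgP[Dv' v'v cv'].
  have Mu' n := Dc_Dmin (Du' n); have Mv' n := Dc_Dmin (Dv' n).
  (* [closed_form] quantifies over all sequences approximating u; an arbitrary one is compared with
     u_n, and closability makes the difference negligible. *)
  pose z n := u' n - u_ n.
  have Dz n : Dmin (z n) by exact: subspaceB Dmin_subspace _ _.
  have zz : z n @[n --> \oo] --> (0 : H) by rewrite -(subrr u); exact: cvgB.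
  have cz : tform_cauchy z by exact: tform_cauchyB.
  have [N1 [M hM]] := tform_bounded Mv' cv'.
  have M0 : 0 <= M by apply: le_trans (hM N1 (leqnn _)); exact: quad_ge0 ht _ _.
  pose r n := tform (u' n) (v' n) - ip g (v' n).
  have r0 : r n @[n --> \oo] --> (0 : R[i]^o).
    apply/(cvg_rnorm_seqP (V := R[i]^o)) => e e0.
    have d0 : 0 < e ^+ 2 / (16 * (M + 1)).
      by rewrite divr_gt0 ?exprn_gt0// mulr_gt0//; lra.
    have [N2 hN2] := tform_closable Dz cz zz d0.
    have [N3] := ltr_add_invr d0; rewrite add0r => hN3.
    exists (maxn N1 (maxn N2 N3)) => n; rewrite !geq_max => /and3P[n1 n2 n3].
    rewrite subr0.
    have -> : r n = tform (z n) (v' n) + (tform (u_ n) (v' n) - ip g (v' n)).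
      by rewrite /r /z (piBl ht)// addrA subrK.
    apply: le_lt_trans (rnormD _ _) _.
    have q1 := pi_cauchy_sqr ht (Dz n) (Mv' n); have q2 := hu n _ (Dv' n).
    have b1 := hN2 n n2; have b2 := hM n n1.
    have b3 : n.+1%:R^-1 <= e ^+ 2 / (16 * (M + 1)).
      apply: le_trans _ (ltW hN3).
      by rewrite lef_pV2 ?posrE ?ltr0n// ler_nat ltnS.
    have v0 := quad_ge0 ht (Mv' n); have zq0 := quad_ge0 ht (Dz n).
    (* With [quad tform (v' n)] at most M, the factor 16 (M + 1) leaves x^2 <= (e/4)^2; the two
       error terms add up to at most e/2. *)
    have half (x p : R) : 0 <= x -> 0 <= p -> p <= e ^+ 2 / (16 * (M + 1)) ->
        x ^+ 2 <= p * quad tform (v' n) -> x <= e / 4.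
      move=> x0 p0 pe xp; rewrite -(@ler_pXn2r _ 2)// ?nnegrE//; last by lra.
      apply: le_trans xp _.
      have : p * quad tform (v' n) <= p * (M + 1) by rewrite ler_wpM2l//; lra.
      have : p * (16 * (M + 1)) <= e ^+ 2 by rewrite -ler_pdivlMr//; lra.
      rewrite expr_div_n; lra.
    have := half _ _ (rnorm_ge0 _) zq0 b1 q1.
    have i0 : (0 : R) <= n.+1%:R^-1 by rewrite invr_ge0.
    have := half _ _ (rnorm_ge0 _) i0 b3 q2.
    lra.
  have e : (fun n => ip (Ac (u' n)) (v' n)) =
      fun n => r n + ip (g + l0%:C *: u' n) (v' n).
    apply/funext => n; rewrite /r /tform (Ac_Amax (Du' n)).2 (ipDl ip_norm).
    by rewrite (ipZl ip_norm); ring.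
  rewrite e; apply: cvg_add0 r0 _; apply: (ip_cvg ip_norm) => //.
  by apply: cvgD; [exact: cvg_cst|apply: cvgZl_tmp].
case: Fu => Fu hw; exists u => //.
have [Dx hx] := friedrichs_Dmax Fu.
have -> : A u = g + l0%:C *: u; last by rewrite addrK.
apply/eqP; rewrite -subr_eq0; apply/eqP/(dense_ortho ip_norm Ac_dense) => v Dv.
have fv := form_cvg_dom (form_cvg_cst Dv).
have := cvg_limE (V := R[i]^o) (hx v fv _ _ fu (form_cvg_cst Dv))
  (hw v fv _ _ fu (form_cvg_cst Dv)).
move=> e; rewrite (ip_conj ip_norm) [X in Num.conj X](_ : _ = 0) ?rmorph0//.
by rewrite (ipBl ip_norm) e subrr.
Qed.

(** Surjectivity gives u in the Friedrichs domain with (A - l0) u = (A - l0) v, and y there with (A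
    - l0) y = v - u. Moving A - l0 across, |v - u|^2 = [y, v - u] + (y, (A - l0)(v - u)) = 0. *)
Lemma friedrichs_maximal v : Dmax v -> (forall u, Fdom u -> omega u v = 0) -> Fdom v.
Proof.
move=> Dv hv; have [u Fu eu] := friedrichs_surj (A v - l0%:C *: v).
have [Du _] := friedrichs_Dmax Fu.
suff -> : v = u by [].
apply/eqP; rewrite -subr_eq0; apply/eqP/(ip_eq0 ip_norm).
have [y Fy ey] := friedrichs_surj (v - u); have [Dy _] := friedrichs_Dmax Fy.
rewrite -{1}ey (ipBl ip_norm) (ipZl ip_norm) !(ipBr ip_norm).
have : omega y v - omega y u = 0 by rewrite hv// friedrichs_isotropic// subrr.
have : ip y (A u - l0%:C *: u) = ip y (A v - l0%:C *: v) by rewrite eu.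
rewrite /omega !(ipBr ip_norm) !(ipZr_real ip_norm) => h1 h2.
rewrite -[RHS]h2; apply/eqP; rewrite -subr_eq0; apply/eqP.
transitivity (- ((ip y (A u) - l0%:C * ip y u) - (ip y (A v) - l0%:C * ip y v))).
  by ring.
by rewrite h1 subrr oppr0.
Qed.

(** (A f - A x, w) is the limit in n of t(u_n - x, w) + l0 (u_n - x, w), where x is a late term of
    the sequence approximating f. Cauchy-Schwarz in the form norm bounds this uniformly in w. *)
Lemma friedrichs_approx f (e : R) : Fdom f -> 0 < e -> exists x,
  [/\ Dc x, rnorm (f - x) <= e
    & forall w, Dmin w -> rnorm (ip (A f - A x) w) <= e * pnorm tform w].
Proof.
move=> Ff e0; have [Df _] := friedrichs_Dmax Ff; have [[u_ cu] _] := Ff.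
move: cu => /form_cvgP[Du /cvg_rnorm_seqP cu ch].
(* The form term contributes d and the l0-term |l0| d, together at most e. *)
pose d := e / (`|l0| + 2); have n0 := normr_ge0 l0.
have de : d * (`|l0| + 2) = e by rewrite divfK// gt_eqF//; lra.
have d0 : 0 < d by rewrite divr_gt0//; lra.
have [N1 h1] := cu _ d0; have [|N2 h2] := ch (d ^+ 2); first by rewrite exprn_gt0.
pose j := maxn N1 N2; exists (u_ j).
have jN2 : (N2 <= j)%N by exact: leq_maxr.
split=> // [|w Dw].
  by rewrite rdistC; have := h1 j (leq_maxl _ _); nra.
have Mj := Dc_Dmin (Du j).
rewrite leNgt; apply/negP => hlt.
(* The gap in the negated bound. The index n may depend on w and is taken so large that |f - u_n| |A
   w| stays below eta, whereas x = u_j does not depend on w. *)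
set eta := rnorm (ip (A f - A (u_ j)) w) - e * pnorm tform w.
have eta0 : 0 < eta by rewrite /eta; lra.
have a0 : 0 < rnorm (A w) + 1 by have := rnorm_ge0 (A w); lra.
have [N3 h3] := cu _ (divr_gt0 eta0 a0).
pose n := maxn N3 j.
have := h3 n (leq_maxl _ _); rewrite ltr_pdivlMr// => hn.
have Mn := Dc_Dmin (Du n).
have nN2 : (N2 <= n)%N by apply: leq_trans jN2 _; exact: leq_maxr.
have Dnj : Dmin (u_ n - u_ j) by exact: subspaceB Dmin_subspace _ _.
have pd : pnorm tform (u_ n - u_ j) <= d.
  rewrite -(@ler_pXn2r _ 2)// ?nnegrE ?pnorm_ge0 ?(ltW d0)// (sqr_pnorm ht)//.
  exact: h2.
have e1 : ip (A f - A (u_ j)) w = ip (f - u_ n) (A w) +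
    (tform (u_ n - u_ j) w + l0%:C * ip (u_ n - u_ j) w).
  rewrite /tform AmaxB; try exact: Dmin_Dmax.
  rewrite !(ipBl ip_norm) (Dmin_greenr Df Dw) (Dmin_green Mn (Dmin_Dmax Dw)); ring.
have : rnorm (ip (A f - A (u_ j)) w) <=
    rnorm (f - u_ n) * rnorm (A w) + (d * pnorm tform w + `|l0| * (d * pnorm tform w)).
  rewrite e1 (le_trans (rnormD _ _))// lerD ?(ip_cauchy ip_norm)//.
  rewrite (le_trans (rnormD _ _))// lerD//.
    rewrite (le_trans (pi_cauchy ht Dnj Dw))// ler_wpM2r ?pnorm_ge0//.
  rewrite rnormM rnorm_real ler_wpM2l// (le_trans (ip_cauchy ip_norm _ _))//.
  rewrite ler_pM ?rnorm_ge0 ?rnorm_le_tform// (le_trans _ pd)// rnorm_le_tform//.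
have := mulr_ge0 (ltW d0) (pnorm_ge0 (f := tform) w).
have := rnorm_ge0 (f - u_ n); rewrite rdistC /eta -de in hn; lra.
Qed.

Lemma friedrichs_lagrangian DF : lin_subspace DF -> DF `<=` E ->
  Fdom = [set u + v | u in DF & v in Dmin] -> lagrangian DF.
Proof.
move=> sDF DFE FE.
have DFF u : DF u -> Fdom u.
  move=> Du; rewrite FE; exists u => //; exists 0; last by rewrite addr0.
  exact: subspace0 Dmin_subspace.
split=> // [u v /DFF Fu /DFF Fv|v Ev hv]; first exact: friedrichs_isotropic.
have : Fdom v.
  apply: friedrichs_maximal; first exact: Espace_Dmax.
  move=> u; rewrite FE => -[x Dx [y Dy <-]].
  rewrite omegaDl; [|exact/Espace_Dmax/DFE|exact: Dmin_Dmax].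
  by rewrite hv// add0r omega_minl//; exact: Espace_Dmax.
rewrite FE => -[x Dx [y Dy e]].
(* v lies in E and x in D_F, so the D_min-part y lies in E as well, and E meets D_min only in 0. *)
suff y0 : y = 0 by rewrite -e y0 addr0.
apply: Espace_Dmin => //.
have -> : y = v - x by rewrite -e addrAC subrr add0r.
exact: subspaceB Espace_subspace Ev (DFE _ Dx).
Qed.

(** * Convergence *)

Lemma Kspace_split l q : Kspace ip Ac l q ->
  exists k w, [/\ kmax l k, Dmin w & k = q + w].
Proof.
move=> [k kk <-]; exists k, (k - pi_max ip Ac k); split => //.
  by have [] := pi_maxP kk.1.
by rewrite addrC subrK.
Qed.

(** The constant term of 1 + 2 |w| + |l0| |w|^2 after |w| <= |k| + 1, 2 |k| <= 1 + |k|^2 and |w|^2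
    <= 2 + 2 |k|^2. *)
Let C0 : R := 4 + 2 * `|l0|.

(** Expanding (A k, k) = l |k|^2 gives t(w, w) - l |k|^2 <= 1 + 2 |w| + |l0| |w|^2 <= C0 + (1 + 2
    |l0|) |k|^2. The condition on l makes 1 + 2 |l0| <= -l/2, so the last term is absorbed on the
    left. *)
Lemma Kspace_estimate l q k w : l <= - (2 + 4 * `|l0|) -> Dmax q ->
  pnorm gip q <= 1 -> kmax l k -> Dmin w -> k = q + w ->
  quad tform w <= C0 /\ - l * rnorm k ^+ 2 <= 2 * C0.
Proof.
move=> ll Dq q1 [Dk Ak] Dw e.
have Mw := Dmin_Dmax Dw.
have id1 : l * rnorm k ^+ 2 = Re (ip (A q) q) + 2 * Re (ip (A q) w) + Re (ip (A w) w).
  have -> : l * rnorm k ^+ 2 = Re (ip (A k) k).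
    by rewrite Ak (ipZl ip_norm) ReZ (ip_real ip_norm).
  rewrite e (AmaxD Dq Mw) (ipDl ip_norm) !(ipDr ip_norm) !ReD.
  by rewrite (Dmin_green Dw Dq) (ip_conj ip_norm w) Re_conjc; ring.
have rq := le_trans (rnorm_le_gip Dq) q1; have rAq := le_trans (rnormA_le_gip Dq) q1.
have rw : rnorm w <= rnorm k + 1.
  have -> : w = k - q by rewrite e addrAC subrr add0r.
  by apply: le_trans (rnormB _ _) _; lra.
have b1 : - Re (ip (A q) q) <= 1.
  rewrite -ReN (le_trans (Re_le_rnorm _))// rnormN (le_trans (ip_cauchy ip_norm _ _))//.
  by rewrite mulr_ile1 ?rnorm_ge0.
have b2 : - Re (ip (A q) w) <= rnorm w.
  rewrite -ReN (le_trans (Re_le_rnorm _))// rnormN (le_trans (ip_cauchy ip_norm _ _))//.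
  by rewrite ler_piMl ?rnorm_ge0.
have qt := quad_tform w; have qw := quad_ge0 ht Dw.
have l0n : - l0 * rnorm w ^+ 2 <= `|l0| * rnorm w ^+ 2.
  by rewrite ler_wpM2r ?sqr_ge0// lerNl lerNnormlW.
have w2 : rnorm w ^+ 2 <= 2 + 2 * rnorm k ^+ 2.
  have := rnorm_ge0 w; have := sqr_ge0 (rnorm k - 1); nra.
have lw2 : `|l0| * rnorm w ^+ 2 <= `|l0| * (2 + 2 * rnorm k ^+ 2).
  by rewrite ler_wpM2l.
have k1 : 2 * rnorm k <= 1 + rnorm k ^+ 2 by have := sqr_ge0 (rnorm k - 1); nra.
have main : quad tform w + - l * rnorm k ^+ 2 <= C0 + (1 + 2 * `|l0|) * rnorm k ^+ 2.
  rewrite /C0; lra.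
have k0 := sqr_ge0 (rnorm k).
have lk : (1 + 2 * `|l0|) * rnorm k ^+ 2 <= - l / 2 * rnorm k ^+ 2.
  by rewrite ler_wpM2r//; lra.
have lk0 : 0 <= (1 + 2 * `|l0|) * rnorm k ^+ 2.
  by rewrite mulr_ge0//; have := normr_ge0 l0; lra.
by split; lra.
Qed.

Lemma omega_small f (e : R) : Fdom f -> 0 < e -> exists L, forall l q, l < L ->
  Kspace ip Ac l q -> pnorm gip q <= 1 -> rnorm (omega f q) <= e.
Proof.
move=> Ff e0; have [Df _] := friedrichs_Dmax Ff.
pose sC := Num.sqrt C0; have sC0 : 0 <= sC by exact: sqrtr_ge0.
(* The w-term costs e1 sC and the q-term e1, together e/2; the other half is kept for the k-term. *)
pose e1 := e / (2 * (1 + sC)).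
have e10 : 0 < e1 by rewrite divr_gt0//; lra.
have ee1 : e1 * (1 + sC) = e / 2 by rewrite /e1; field; lra.
have [x [Dx fx hx]] := friedrichs_approx Ff e10.
have Mx := Dc_Dmin Dx.
pose B := rnorm (A f - A x); have B0 : 0 <= B by exact: rnorm_ge0.
have C00 : 0 < C0 by rewrite /C0; have := normr_ge0 l0; lra.
(* From -l |k|^2 <= 2 C0, the bound -l >= L2 gives (B |k|)^2 <= (e/2)^2. B depends on x, which is
   already fixed. *)
pose L2 := 8 * C0 * (B ^+ 2 + 1) / e ^+ 2.
have e20 : 0 < e ^+ 2 by rewrite exprn_gt0.
exists (Num.min (- (2 + 4 * `|l0|)) (- L2)) => l q; rewrite lt_min => /andP[l1 l2] Kq q1.
have KE := let: And4 _ h _ _ := Kspace_lagrangian l in h.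
have Eq := KE _ Kq; have Dq := Espace_Dmax Eq.
have [k [w [kk Dw ek]]] := Kspace_split Kq.
have [tw rk] := Kspace_estimate (ltW l1) Dq q1 kk Dw ek.
have ew : omega f q = ip (A f - A x) k - ip (A f - A x) w - ip (f - x) (A q).
  rewrite /omega ek !(ipDr ip_norm) !(ipBl ip_norm) -(Dmin_green Mx Dq); ring.
have t1 : rnorm (ip (A f - A x) k) <= e / 2.
  apply: le_trans (ip_cauchy ip_norm _ _) _; rewrite -/B.
  rewrite -(@ler_pXn2r _ 2)// ?nnegrE; [|by rewrite mulr_ge0 ?rnorm_ge0|by lra].
  have lp : 0 < - l by have := normr_ge0 l0; lra.
  rewrite -(ler_pM2l lp) exprMn.
  have h1 : 8 * C0 * (B ^+ 2 + 1) <= - l * e ^+ 2 by rewrite -ler_pdivrMr// -/L2; lra.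
  have h2 : B ^+ 2 * (- l * rnorm k ^+ 2) <= B ^+ 2 * (2 * C0) by rewrite ler_wpM2l ?sqr_ge0.
  rewrite expr_div_n; lra.
have t2 : rnorm (ip (A f - A x) w) <= e1 * sC.
  by apply: le_trans (hx w Dw) _; rewrite ler_pM2l// /sC ler_wsqrtr.
have t3 : rnorm (ip (f - x) (A q)) <= e1.
  apply: le_trans (ip_cauchy ip_norm _ _) _.
  have rAq := le_trans (rnormA_le_gip Dq) q1.
  have := rnorm_ge0 (f - x); have := rnorm_ge0 (A q); nra.
rewrite ew; have := rnormB (ip (A f - A x) k - ip (A f - A x) w) (ip (f - x) (A q)).
have := rnormB (ip (A f - A x) k) (ip (A f - A x) w); lra.
Qed.

Lemma pnorm_gip_A r : E r -> pnorm gip (A r) = pnorm gip r.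
Proof.
by move=> Er; rewrite /pnorm !quad_gip (Espace_AA Er).2 rnormN addrC.
Qed.

(** The threshold L precedes the basis b: bases of K_l are picked separately for each l, with no
    continuity in l. *)
Lemma Kspace_proj_small f (e : R) : Fdom f -> E f -> 0 < e ->
  exists L, forall l n (b : 'I_n -> H), l < L -> orthonormal gip b ->
    lin_span b = Kspace ip Ac l -> pnorm gip (f - ortho_proj gip b f) <= e.
Proof.
move=> Ff Ef e0; have [L hL] := omega_small Ff e0; exists L => l n b lL ob sb.
have hg := gip_pre_inner; have lag := Kspace_lagrangian l; have [sK KE _ _] := lag.
have Kb i : Kspace ip Ac l (b i) by rewrite -sb; exact: span_mem.
have Db i := Espace_Dmax (KE _ (Kb i)); have Df := Espace_Dmax Ef.
set p := ortho_proj gip b f; set r := f - p.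
have Kp : Kspace ip Ac l p by rewrite -sb; exists (fun i => gip f (b i)).
have Ep := KE _ Kp; have Dp := Espace_Dmax Ep.
have Er : E r by exact: subspaceB Espace_subspace _ _.
have Dr := Espace_Dmax Er.
have rK v : Kspace ip Ac l v -> gip r v = 0.
  by rewrite -sb; exact: (ortho_projP hg).
have KAr := lagrangian_perp lag Er rK.
have EAr := Espace_A Er; have DAr := Espace_Dmax EAr.
have [r0|r0] := eqVneq (pnorm gip r) 0; first by rewrite r0 ltW.
have rp : 0 < pnorm gip r by rewrite lt_neqAle eq_sym r0 pnorm_ge0.
pose a := (pnorm gip r)^-1.
have a0 : 0 <= a by rewrite invr_ge0 ltW.
(* A is isometric on E, so A r / |r|_A is a unit vector of K_l, and its pairing with f is |r|_A. *)
have := hL l (a%:C *: A r) lL (subspaceZ _ sK KAr).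
rewrite (pnormZ hg)// rnorm_real (ger0_norm a0) pnorm_gip_A// mulVf// => /(_ (lexx _)).
rewrite /omega (AmaxZ _ DAr) !(ipZr_real ip_norm) -mulrBr -/(omega f (A r)) omega_A//.
have -> : gip f r = (pnorm gip r ^+ 2)%:C.
  rewrite (sqr_pnorm hg)// -(quadE hg)// {2}/r (piBl hg)//.
  by rewrite (pi_herm hg Dp Dr) rK// rmorph0 subr0.
rewrite rnormM !rnorm_real (ger0_norm a0) (ger0_norm (sqr_ge0 _)).
by rewrite expr2 mulrA mulVf// mul1r.
Qed.

(** If the combination of b' vanishes, c_j is the graph inner product of b_j with the combination of
    the b_i - b'_i, so |c_j| <= e S with S the sum of the |c_i|. Summing over j, S <= n e S, hence S
    = 0. *)
Lemma orthonormal_close_indep n (b b' : 'I_n -> H) (e : R) :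
  (forall i, Dmax (b i)) -> (forall i, Dmax (b' i)) -> orthonormal gip b ->
  (forall i, pnorm gip (b i - b' i) <= e) -> n%:R * e < 1 ->
  forall c, lincomb b' c = 0 -> forall i, c i = 0.
Proof.
move=> Db Db' ob be ne c c0; have hg := gip_pre_inner.
have Dbb i : Dmax (b i - b' i) by exact: subspaceB Dmax_subspace _ _.
pose S : R := \sum_i rnorm (c i).
have cS j : rnorm (c j) <= e * S.
  rewrite -(lincomb_orthonormal hg c j Db ob) -[lincomb b c]subr0 -c0 lincombBv.
  apply: le_trans (pi_cauchy hg _ (Db j)) _.
    exact: subspace_lincomb Dmax_subspace _.
  have -> : pnorm gip (b j) = 1 by rewrite /pnorm /quad ob eqxx /= sqrtr1.
  rewrite mulr1 (le_trans (pnorm_lincomb hg _ _))// mulrC mulr_suml ler_sum// => i _.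
  by rewrite ler_wpM2l ?rnorm_ge0.
have S0 : 0 <= S by apply: sumr_ge0 => i _; exact: rnorm_ge0.
have SS : S <= n%:R * e * S.
  rewrite {1}/S (le_trans (ler_sum _ (fun i _ => cS i)))//.
  by rewrite sumr_const card_ord -[leLHS]mulr_natl mulrA.
have {SS}S0 : S = 0 by apply/eqP; rewrite eq_le S0 andbT; nra.
move=> i; apply: rnorm0_eq0; apply/eqP; rewrite eq_le rnorm_ge0 andbT.
by rewrite (le_trans (cS i))// S0 mulr0.
Qed.

Lemma Amin_shift_injective l : l < l0 + 1 -> injective_shift (Amin ip Ac) l%:C.
Proof.
move=> ll u v; rewrite !inE => Du Dv; rewrite -!/(A _) => e.
have Duv : Dmin (u - v) by exact: subspaceB Dmin_subspace _ _.
have Auv : A (u - v) = l%:C *: (u - v).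
  rewrite (AmaxB (Dmin_Dmax Du) (Dmin_Dmax Dv)) scalerBr; apply/eqP.
  by rewrite subr_eq -addrA [- _ + _]addrC -[A v - _]e addrC subrK.
have := Dmin_below Duv; rewrite Auv (ipZl ip_norm) ReZ (ip_real ip_norm) /= => h.
apply/eqP; rewrite -subr_eq0; apply/eqP/rnorm0_eq0/eqP.
rewrite -sqrf_eq0 eq_le sqr_ge0 andbT leNgt; apply/negP => h0.
by move: h; rewrite ler_pM2r// leNgt ll.
Qed.

Lemma Kspace_Gr_limit d (d_index : d%:Z = - fredholm_index (Amin ip Ac))
    (DF : set H) (DF_lin : lin_subspace DF) (DF_sub : DF `<=` E)
    (DF_def : Fdom = [set u + v | u in DF & v in Dmin]) (Lambda : set R) :
  exists (K : R -> Gr E d) (F : Gr E d),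
    [/\ forall l, gr_set (K l) = Kspace ip Ac l, gr_set F = DF
      & K l @[l --> within Lambda -oo] --> F].
Proof.
have [b0 [ob0 sb0]] := index_Kspace0 d_index.
have lag_basis L : lagrangian L ->
    exists b : 'I_d -> H, orthonormal gip b /\ lin_span b = L.
  move=> lL; have [k [b [ob sb]]] := lagrangian_basis lL.
  have kd : k = d := lagrangian_dim lL ob sb (Kspace_lagrangian 0) ob0 sb0.
  by case: _ / kd; exists b.
have span_frame L (b : 'I_d -> H) : lagrangian L -> orthonormal gip b ->
    lin_span b = L -> frames E d b.
  move=> [_ LE _ _] ob sb.
  have Eb i : E (b i) by apply: LE; rewrite -sb; exact: span_mem.
  split=> //; apply: (orthonormal_indep gip_pre_inner) => // i.
  exact: Espace_Dmax.
have lagGr L : lagrangian L -> exists W : Gr E d, gr_set W = L.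
  move=> lL; have [b [ob sb]] := lag_basis L lL.
  have h : exists2 b, frames E d b & lin_span b = L.
    by exists b => //; exact: span_frame ob sb.
  by exists (MkGr h).
have lagF := friedrichs_lagrangian DF_lin DF_sub DF_def.
have [F eF] := lagGr DF lagF.
have [K eK] := choice (fun l => lagGr _ (Kspace_lagrangian l)).
exists K, F; split => // U; rewrite nbhsE => -[B [oB BF] BU].
have [b [ob sb]] := lag_basis DF lagF.
have fb := span_frame DF b lagF ob sb.
have [O oO eO] : gr_open B by exact: oB.
have Ob : O b.
  suff : gr_preimage B b by rewrite eO => -[].
  by split=> //; exists F => //; rewrite eF.
have [de de0 hde] := ptws_open_rnorm oO Ob.
(* The first bound keeps the projected frame in O; the second gives d e < 1, which keeps it
   independent. *)
pose e := Num.min (de / 2) (d.+1%:R^-1).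
have e0 : 0 < e by rewrite lt_min invr_gt0 ltr0n divr_gt0.
have ede : e < de by rewrite gt_min ltr_pdivrMr// mulr_natr mulr2n ltrDl de0.
have ned : d%:R * e < 1.
  have : e <= d.+1%:R^-1 by rewrite ge_min lexx orbT.
  by rewrite -[d.+1%:R^-1]mul1r ler_pdivlMr ?ltr0n// -natr1; lra.
have FDF f : DF f -> Fdom f.
  move=> Df; rewrite DF_def; exists f => //; exists 0; last by rewrite addr0.
  exact: subspace0 Dmin_subspace.
have bDF i : DF (b i) by rewrite -sb; exact: span_mem.
have near_small : \forall l \near -oo%R, forall i n (c : 'I_n -> H),
    orthonormal gip c -> lin_span c = Kspace ip Ac l ->
    pnorm gip (b i - ortho_proj gip c (b i)) <= e.
  apply: filter_forall => i.
  have [L hL] := Kspace_proj_small (FDF _ (bDF i)) (DF_sub _ (bDF i)) e0.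
  apply: filterS (nbhs_ninfty_lt (num_real L)) => l lL n c.
  exact: hL.
rewrite /= /within /=; apply: filterS near_small => l small _; apply: BU.
have lagK := Kspace_lagrangian l; have [c [oc sc]] := lag_basis _ lagK.
have [_ KE _ _] := lagK.
pose b' i := ortho_proj gip c (b i).
have Kb' i : Kspace ip Ac l (b' i) by rewrite -sc; exists (fun j => gip (b i) (c j)).
have Eb' i : E (b' i) by exact: KE.
have Db' i : Dmax (b' i) by exact: Espace_Dmax.
have Db i : Dmax (b i) by apply/Espace_Dmax/DF_sub.
have bb' i : pnorm gip (b i - b' i) <= e by exact: small.
have indb' := orthonormal_close_indep Db Db' ob bb' ned.
(* d independent vectors inside a span of d vectors exhaust it, so b' is a frame of K_l lying in
   O. *)
have sb' : lin_span b' = Kspace ip Ac l.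
  by rewrite -sc; apply: indep_span => // i; rewrite sc.
have : gr_preimage B b'.
  rewrite eO; split; first by split.
  apply: hde => i; apply: le_lt_trans ede; apply: le_trans (bb' i).
  exact: rnorm_le_gip (subspaceB Dmax_subspace (Db i) (Db' i)).
move=> [_ [W BW eW]]; suff -> : K l = W by [].
by apply: gr_eq; rewrite -eW sb' eK.
Qed.

End AdjointExtension.

Theorem theorem6p9 (R : realType) (H : completeNormedModType R[i])
    (ip : {dot H for Num.conj})
    (ip_norm : forall u : H, ip u u = `|u| ^+ 2)
    (H_separable : separable H)
    (Ac : operator (H := H))
    (Ac_linear : linear_operator Ac)
    (Ac_dense : densely_defined Ac)
    (Ac_sym : symmetric_operator ip Ac)
    (Ac_below : bounded_below ip Ac)
    (incl_compact : compact_inclusion ip (Amax ip Ac))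
    (Dmin_codim : exists2 n, (0 < n)%N & has_codim (Dmin Ac) (Dmax ip Ac) n)
    (d : nat) (d_index : d%:Z = - fredholm_index (Amin ip Ac))
    (DF : set H) (DF_lin : lin_subspace DF) (DF_sub : DF `<=` Espace ip Ac)
    (DF_def : friedrichs_dom ip Ac = [set u + v | u in DF & v in Dmin Ac]) :
  let Lambda := [set l : R | l < 0 /\ injective_shift (Amin ip Ac) l%:C] in
  (\forall l \near -oo, Lambda l) /\
  exists (K : R -> Gr (Espace ip Ac) d) (F : Gr (Espace ip Ac) d),
    [/\ forall l, Lambda l -> gr_set (K l) = Kspace ip Ac l,
        gr_set F = DF
      & K l @[l --> within Lambda -oo] --> F].
Proof.
move=> Lambda; have [m hm] := Ac_below.
(* The lower bound m is written as l0 + 1, with l0 = m - 1. *)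
have {}hm u : dom Ac u -> (m - 1 + 1)%:C * `|u| ^+ 2 <= ip (Ac u) u.
  by rewrite subrK; exact: hm.
split.
  near=> l; split; first by near: l; exact: nbhs_ninfty_lt.
  apply: (Amin_shift_injective ip_norm Ac_linear Ac_dense Ac_sym hm).
  by near: l; apply: nbhs_ninfty_lt; exact: num_real.
have [K [F [eK eF cK]]] := Kspace_Gr_limit ip_norm Ac_linear Ac_dense Ac_sym
  incl_compact Dmin_codim hm d_index DF_lin DF_sub DF_def Lambda.
by exists K, F; split => // l _; exact: eK.
Unshelve. all: by end_near.
Qed.
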